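(* Let $M_n$, $n\ge1$, be random measures on a Polish space $\mathbb S$ such that $M_n\to M$ in distribution (with respect to the vague topology) as $n\to\infty$. If every $M_n$ is negatively associated, then $M$ is negatively associated; if every $M_n$ is positively associated, then $M$ is positively associated.
   Context: $\mathbb S$ is Polish with a fixed complete metric; bounded sets refer to this metric. $\mathbf M(\mathbb S)$ is the space of measures finite on bounded Borel sets, with the vague topology: $\mu_n\to\mu$ iff $\int f\,d\mu_n\to\int f\,d\mu$ for every continuous $f:\mathbb S\to\mathbb R_+$ with bounded support; it carries the partial order $\mu<\nu$ iff $\mu(B)\le\nu(B)$ for all bounded Borel $B$. A random measure is a random element of $\mathbf M(\mathbb S)$. A measurable $f$ on $\mathbf M(\mathbb S)$ is measurable with respect to a Borel set $A$ if $f(\mu)=f(\mu(\cdot\cap A))$ for all $\mu$. $M$ is positively associated (PA) if $\mathbb E[f(M)g(M)]\ge\mathbb E[f(M)]\mathbb E[g(M)]$ for all bounded measurable non-decreasing (w.r.t. $<$) $f,g$; it is negatively associated (NA) if $\mathbb E[f(M)g(M)]\le\mathbb E[f(M)]\mathbb E[g(M)]$ for all bounded measurable non-decreasing $f,g$ measurable with respect to disjoint Borel sets $A,B$ respectively. *)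

(* Defs.v *)
From HB Require Import structures.
From mathcomp Require Import all_boot all_order all_algebra.
From mathcomp Require Import all_classical all_reals all_analysis measurable_realfun.
Set Implicit Arguments.
Unset Strict Implicit.
Unset Printing Implicit Defensive.
Import Order.TTheory GRing.Theory Num.Theory.
Import numFieldNormedType.Exports.
Local Open Scope classical_set_scope.
Local Open Scope ring_scope.

Section RandomMeasures.
Variables (R : realType) (S : completePseudoMetricType R).

(** The Polish hypothesis: the (complete) metric structure of [S] is a
    genuine metric (Hausdorff) and [S] is separable. *)
Definition polish_space : Prop :=
  hausdorff_space S /\ exists D : set S, countable D /\ dense D.

Definition borelS := g_sigma_algebraType (@open S).

Definition mbounded (B : set S) : Prop := exists (x : S) (r : R), B `<=` ball x r.

Definition MS := {measure set borelS -> \bar R}.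

Definition locfin (mu : MS) : Prop :=
  forall B : set borelS, measurable B -> mbounded B -> (mu B < +oo)%E.

Definition meas_le (mu nu : MS) : Prop :=
  forall B : set borelS, measurable B -> mbounded B -> (mu B <= nu B)%E.

Definition restr (A : set borelS) (mA : measurable A) (mu : MS) : MS :=
  Measure.clone _ _ _ (mrestr mu mA) _.

Definition eval_gen : set (set MS) :=
  fun X => exists (B : set borelS) (E : set (\bar R)),
    measurable B /\ measurable E /\ X = locfin `&` ((fun mu : MS => mu B) @^-1` E).

Definition MS_measurable : set (set MS) := <<s locfin, eval_gen >>.

Definition MS_measurable_fun (f : MS -> R) : Prop :=
  forall E : set R, measurable E -> MS_measurable (locfin `&` f @^-1` E).

Definition MS_bounded_fun (f : MS -> R) : Prop :=
  exists C : R, forall mu, locfin mu -> `|f mu| <= C.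

Definition MS_nondecreasing (f : MS -> R) : Prop :=
  forall mu nu, locfin mu -> locfin nu -> meas_le mu nu -> f mu <= f nu.

Definition MS_fun_wrt (A : set borelS) (mA : measurable A) (f : MS -> R) : Prop :=
  forall mu, locfin mu -> f mu = f (restr mA mu).

Definition CcS (g : S -> R) : Prop :=
  continuous g /\ (forall x, 0 <= g x) /\ mbounded (closure [set x | g x != 0]).

Definition vint (mu : MS) (g : S -> R) : \bar R := (\int[mu]_(x in setT) (g x)%:E)%E.

(** Continuity of f on M(S) for the vague topology, i.e. the coarsest topology
    making all maps mu |-> \int g dmu (g in CcS) continuous. *)
Definition vague_continuous (f : MS -> R) : Prop :=
  forall mu, locfin mu -> forall e : R, 0 < e ->
    exists (k : nat) (gs : nat -> S -> R) (U : nat -> set (\bar R)),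
      (forall i, (i < k)%N -> CcS (gs i) /\ nbhs (vint mu (gs i)) (U i)) /\
      (forall nu, locfin nu -> (forall i, (i < k)%N -> U i (vint nu (gs i))) ->
         `|f nu - f mu| < e).

Definition random_measure d (Omega : measurableType d) (M : Omega -> MS) : Prop :=
  (forall w, locfin (M w)) /\
  (forall X, MS_measurable X -> measurable (M @^-1` X)).

Definition expect d (Omega : measurableType d) (P : probability Omega R)
  (M : Omega -> MS) (f : MS -> R) : \bar R :=
  (\int[P]_(w in setT) (f (M w))%:E)%E.

Definition pos_assoc d (Omega : measurableType d) (P : probability Omega R)
  (M : Omega -> MS) : Prop :=
  forall f g : MS -> R,
    MS_bounded_fun f -> MS_bounded_fun g ->
    MS_measurable_fun f -> MS_measurable_fun g ->
    MS_nondecreasing f -> MS_nondecreasing g ->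
    (expect P M f * expect P M g <= expect P M (fun mu => (f mu * g mu)%R))%E.

Definition neg_assoc d (Omega : measurableType d) (P : probability Omega R)
  (M : Omega -> MS) : Prop :=
  forall (A B : set borelS) (mA : measurable A) (mB : measurable B),
    A `&` B = set0 ->
  forall f g : MS -> R,
    MS_bounded_fun f -> MS_bounded_fun g ->
    MS_measurable_fun f -> MS_measurable_fun g ->
    MS_nondecreasing f -> MS_nondecreasing g ->
    MS_fun_wrt mA f -> MS_fun_wrt mB g ->
    (expect P M (fun mu => (f mu * g mu)%R) <= expect P M f * expect P M g)%E.

Definition cvg_in_dist (dn : nat -> measure_display)
  (Omn : forall n, measurableType (dn n)) (Pn : forall n, probability (Omn n) R)
  (Mn : forall n, Omn n -> MS)
  d (Om : measurableType d) (P : probability Om R) (M : Om -> MS) : Prop :=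
  forall h : MS -> R, MS_bounded_fun h -> vague_continuous h ->
    (fun n => expect (Pn n) (Mn n) h) @ \oo --> expect P M h.

End RandomMeasures.

Arguments MS {R} S.

(* Main.v *)
(** The proof transfers covariance inequalities along the vague convergence
    for functionals [F (int g_1, ..., int g_k)] with [F] bounded, Lipschitz and
    nondecreasing and [g_i] continuous bumps, and shows that these functionals
    approximate every bounded measurable nondecreasing [f] in [L^1] of the law
    of the limit [M], with the constraint of being measurable with respect to a
    given Borel set respected.

    By a layer cake decomposition [f] may be the indicator of an up-set [V].
    The law of [M] is inner regular with respect to families [K] of measures
    that are closed for setwise convergence on countably many sets, so let
    [K] be such a subset of [V].  The Lipschitz monotone functionals
    [sup_(nu in K) (1 - n sum_(cells B) (nu B - mu B)^+)^+], with cells taken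
    from finer and finer partitions, are at least [1] on [K]; if they do not
    vanish eventually at [mu], then [K] contains measures almost dominated by
    [mu], and an ultralimit of them (after clipping their densities with
    respect to [mu]) is a content dominated by [mu], hence a measure, hence an
    element of [K] below [mu], so that [mu] is in [V].  Finally the cells are
    replaced by closed subsets, by inner regularity on the Polish space, and
    the masses of closed sets by integrals of bumps.  For negative association
    the bumps of [f] and [g] are given disjoint supports. *)
Require Import Defs.
From HB Require Import structures.
From mathcomp Require Import all_boot all_order all_algebra.
From mathcomp Require Import all_classical all_reals all_analysis measurable_realfun.
From mathcomp Require Import lra ring.
Set Implicit Arguments.
Unset Strict Implicit.
Unset Printing Implicit Defensive.
Import Order.TTheory GRing.Theory Num.Theory.
Import numFieldNormedType.Exports.
Local Open Scope classical_set_scope.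
Local Open Scope ring_scope.


(** Nondecreasing functionals are not stable under complements, so no monotone class argument can
    stay among them. For this reason regularity is proved for all measurable families, and
    monotonicity is restored only afterwards, by the supremum over [K]. No compactness of [K] is
    asked for: what is compact is the set of contents below one fixed locally finite [mu], and
    countable additivity survives there because [mu] dominates. Approximation in [L^1] takes place
    under the law of [M] alone. The laws of the [Mn n] enter only through the sign of a covariance
    at each [n] and through convergence of expectations of vaguely continuous functionals. For
    negative association, a bump around a closed part of [A] may spill out of [A]. This is harmless,
    since each [Mn n] may be tested with any two disjoint Borel sets: the points nearer to one of
    two disjoint closed sets than to the other take the place of [A] and [B]. *)

(** * Inner regularity of subadditive set functions *)

Section inner_regularity.
Context d (T : measurableType d) (R : realType).
Variables (q : set T -> \bar R) (Kc : set (set T)).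
Hypothesis q0 : q set0 = 0%E.
Hypothesis q_ge0 : forall A, (0 <= q A)%E.
Hypothesis q_le : forall A B, measurable A -> measurable B -> A `<=` B ->
  (q A <= q B)%E.
Hypothesis q_sub : forall F : (set T)^nat, (forall n, measurable (F n)) ->
  (q (\bigcup_n F n) <= \sum_(n <oo) q (F n))%E.
Hypothesis q_cvg0 : forall F : (set T)^nat, (forall n, measurable (F n)) ->
  nonincreasing_seq F -> \bigcap_n F n = set0 -> q (F n) @[n --> \oo] --> 0%E.
Hypothesis Kc_meas : Kc `<=` measurable.
Hypothesis Kc0 : Kc set0.
Hypothesis KcT : Kc setT.
Hypothesis KcU : forall A B, Kc A -> Kc B -> Kc (A `|` B).
Hypothesis Kc_bigcap : forall F : (set T)^nat, (forall n, Kc (F n)) ->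
  Kc (\bigcap_n F n).

(** A subadditive [q] replaces a measure because one of its later instances is the expectation of a
    mass capped at [1], which is not additive. *)
Definition inner_regular (V : set T) := measurable V /\
  forall e : R, 0 < e -> exists K, [/\ Kc K, K `<=` V & (q (V `\` K) <= e%:E)%E].

Let q_subU A B : measurable A -> measurable B -> (q (A `|` B) <= q A + q B)%E.
Proof.
move=> mA mB; rewrite -bigcup2E; apply: (le_trans (q_sub _)).
  by move=> [|[|n]] //=.
rewrite (nneseries_split 0%N 2%N)//.
rewrite add0n big_mkord !big_ord_recl big_ord0/= adde0 eseries0 ?adde0//.
by move=> [|[|n]].
Qed.

Let Kc_bigsetU (F : (set T)^nat) n : (forall i, Kc (F i)) ->
  Kc (\big[setU/set0]_(i < n) F i).
Proof. by move=> h; elim/big_ind : _. Qed.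

Let inner_regular_approx (V : (set T)^nat) (e : R) : 0 < e ->
  (forall n, inner_regular (V n)) -> exists K : (set T)^nat,
  [/\ forall n, Kc (K n), forall n, K n `<=` V n &
      (q (\bigcup_n (V n `\` K n)) <= e%:E)%E].
Proof.
move=> e0 hV.
have /choice[K hK] : forall n, exists K, [/\ Kc K, K `<=` V n &
    (q (V n `\` K) <= (e / 2 ^+ n.+1)%:E)%E].
  by move=> n; case: (hV n) => _; apply; rewrite divr_gt0// exprn_gt0.
exists K; split; [by move=> n; case: (hK n)..|].
apply: (le_trans (q_sub _)).
  move=> n; apply: measurableD; first by case: (hV n).
  by apply: Kc_meas; case: (hK n).
apply: (@le_trans _ _ (\sum_(n <oo) (e / 2 ^+ n.+1)%:E)%E).
  by apply: lee_nneseries => // n _; case: (hK n).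
have := @epsilon_trick0 R e xpredT (ltW e0).
by under eq_eseriesr do rewrite natrX.
Qed.

(** [Kc] is assumed stable under finite unions only, so the union is cut at a finite index. The part
    cut off, [W n], decreases to the empty set and costs at most half of [e] by [q_cvg0]; the other
    half pays for the approximation of the single sets. *)
Lemma inner_regular_bigcup (V : (set T)^nat) : (forall n, inner_regular (V n)) ->
  inner_regular (\bigcup_n V n).
Proof.
move=> hV; have mV n : measurable (V n) by case: (hV n).
split; first exact: bigcupT_measurable.
move=> e e0; have e20 : 0 < e / 2 by rewrite divr_gt0.
have [K [KK KV qK]] := inner_regular_approx e20 hV.
have mK n : measurable (K n) by exact: Kc_meas.
pose W n := \bigcup_n V n `\` \big[setU/set0]_(i < n) V i.
have mW n : measurable (W n).
  apply: measurableD; first exact: bigcupT_measurable.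
  by apply: bigsetU_measurable.
have := q_cvg0 mW.
have dW : nonincreasing_seq W.
  move=> m n mn; apply/subsetPset; apply: setDS.
  exact: subset_bigsetU.
have W0 : \bigcap_n W n = set0.
  rewrite -subset0 => x hx.
  have [[i _ Vix] _] := hx 0%N I.
  have [_] := hx i.+1 I; apply.
  by rewrite big_ord_recr/=; right.
move=> /(_ dW W0) /fine_cvgP[hfin] /cvgrPdist_le/(_ _ e20) hW.
have [n [fn hn]] : exists n, q (W n) \is a fin_num /\ `|0 - fine (q (W n))| <= e / 2.
  have [n _ hn] := filterI hfin hW; exists n; exact: (hn n (leqnn n)).
exists (\big[setU/set0]_(i < n) K i); split; first exact: Kc_bigsetU.
  rewrite -bigcup_mkord => x [i _ Kix].
  by exists i => //; exact: KV.
have mUK : measurable (\bigcup_n (V n `\` K n)).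
  by apply: bigcupT_measurable => i; exact: measurableD.
apply: (@le_trans _ _ (q (W n `|` \bigcup_n (V n `\` K n)))).
  apply: q_le.
  - apply: measurableD; first exact: bigcupT_measurable.
    by apply: bigsetU_measurable.
  - exact: measurableU.
  - move=> x [Vx nKx].
    have [hx|nVx] := pselect ((\big[setU/set0]_(i < n) V i) x); last by left.
    right; move: hx; rewrite -bigcup_mkord => -[i ilt Vix].
    exists i => //; split => // Kix; apply: nKx.
    by rewrite -bigcup_mkord; exists i.
apply: (le_trans (q_subU _ _)) => //.
rewrite [e]splitr EFinD; apply: leeD => //.
by rewrite -(fineK fn) lee_fin (le_trans _ hn)// sub0r normrN ler_norm.
Qed.

Lemma inner_regular_bigcap (V : (set T)^nat) : (forall n, inner_regular (V n)) ->
  inner_regular (\bigcap_n V n).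
Proof.
move=> hV; have mV n : measurable (V n) by case: (hV n).
split; first exact: bigcapT_measurable.
move=> e e0.
have [K [KK KV qK]] := inner_regular_approx e0 hV.
have mK n : measurable (K n) by exact: Kc_meas.
exists (\bigcap_n K n); split; first exact: Kc_bigcap.
  by move=> x hx n _; apply: KV; exact: hx.
apply: le_trans qK; apply: q_le.
- by apply: measurableD; exact: bigcapT_measurable.
- by apply: bigcupT_measurable => i; exact: measurableD.
- move=> x [Vx] /existsNP[n] /not_implyP[_ nKx].
  by exists n => //; split => //; exact: Vx.
Qed.

Lemma inner_regular_Kc V : Kc V -> inner_regular V.
Proof.
move=> KV; split; first exact: Kc_meas.
by move=> e e0; exists V; split => //; rewrite setDv q0 lee_fin ltW.
Qed.

(** Regularity alone need not pass to complements; asking for it on both sides makes complements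
    free, and the two preceding closure properties exchange roles under complement. *)
Lemma inner_regular_sigma_algebra :
  sigma_algebra setT [set V | inner_regular V /\ inner_regular (~` V)].
Proof.
split.
- by split; [|rewrite setC0]; exact: inner_regular_Kc.
- by move=> A [? ?]; rewrite setTD; split => //=; rewrite setCK.
- move=> F hF; split; first by apply: inner_regular_bigcup => n; case: (hF n).
  by rewrite setC_bigcup; apply: inner_regular_bigcap => n; case: (hF n).
Qed.

End inner_regularity.

(** * Monotone Lipschitz functions of finitely many coordinates *)

Section one_sided_lipschitz.
Context (R : realType) (I : eqType).
Implicit Types (F : (I -> R) -> R) (L : R) (s : seq I) (y z : I -> R).

(* One inequality encodes that [F] is nondecreasing, Lipschitz, and depends
   only on the coordinates in [s]. *)
Definition oslip F L s := 0 <= L /\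
  forall y z, F y - F z <= L * \sum_(i <- s) Num.max 0 (y i - z i).

Lemma oslip_nondecreasing F L s y z : oslip F L s ->
  (forall i, i \in s -> y i <= z i) -> F y <= F z.
Proof.
move=> [L0 hF] yz; rewrite -subr_le0 (le_trans (hF _ _))//.
rewrite big_seq big1 ?mulr0// => i si.
by apply/max_idPl; rewrite subr_le0 yz.
Qed.

Lemma oslip_eq F L s y z : oslip F L s ->
  (forall i, i \in s -> y i = z i) -> F y = F z.
Proof.
move=> hF yz; apply/eqP; rewrite eq_le; apply/andP.
by split; apply: (oslip_nondecreasing hF) => i si; rewrite yz.
Qed.

Lemma oslip_lipschitz F L s y z : oslip F L s ->
  `|F y - F z| <= L * \sum_(i <- s) `|y i - z i|.
Proof.
move=> [L0 hF]; rewrite ler_norml; apply/andP; split.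
  rewrite lerNl opprB (le_trans (hF _ _))// ler_wpM2l// ler_sum// => i _.
  by rewrite ge_max normr_ge0/= distrC ler_norm.
rewrite (le_trans (hF _ _))// ler_wpM2l// ler_sum// => i _.
by rewrite ge_max normr_ge0/= ler_norm.
Qed.

Lemma oslip_cst c s : oslip (fun=> c) 0 s.
Proof. by split=> // y z; rewrite subrr mul0r. Qed.

Lemma oslip_add F G L L' s s' : oslip F L s -> oslip G L' s' ->
  oslip (fun y => F y + G y) (L + L') (s ++ s').
Proof.
move=> [L0 hF] [L'0 hG]; split; first exact: addr_ge0.
move=> y z; rewrite opprD addrACA.
have hs t : 0 <= \sum_(i <- t) Num.max 0 (y i - z i).
  by apply: sumr_ge0 => i _; rewrite le_max lexx.
rewrite (le_trans (lerD (hF _ _) (hG _ _)))// mulrDl big_cat/= lerD//.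
  by rewrite ler_wpM2l// lerDl.
by rewrite ler_wpM2l// lerDr.
Qed.

Lemma oslip_scale F L s c : 0 <= c -> oslip F L s ->
  oslip (fun y => c * F y) (c * L) s.
Proof.
move=> c0 [L0 hF]; split; first exact: mulr_ge0.
by move=> y z; rewrite -mulrBr -mulrA ler_wpM2l.
Qed.

(* Since [F] is the supremum of [F r - L * sum (r - y)^+] over points [r] with
   rational coordinates, [F] is a countable supremum of measurable functions. *)
Lemma oslip_measurable F L s d (T : measurableType d) (y : T -> I -> R) :
  oslip F L s ->
  (forall i, i \in s -> measurable_fun [set: T] (fun w => y w i)) ->
  measurable_fun [set: T] (fun w => F (y w)).
Proof.
move=> hF my; apply: (measurability _ (RGenOInfty.measurableE R)).
move=> _ [_ [a ->] <-]; rewrite setTI.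
(* Rational points are coded by lists read along [s], so that the union below runs over a countable
   type; missing coordinates default to [0]. *)
pose r (l : seq rat) i : R := ratr (nth 0%R l (index i s)).
pose g l w := F (r l) - L * \sum_(i <- s) Num.max 0 (r l i - y w i).
rewrite [X in measurable X](_ : _ = \bigcup_(l : seq rat) [set w | a < g l w]).
  apply: countable_bigcupT_measurable => [|l]; first exact: countableP.
  have mg : measurable_fun [set: T] (g l).
    apply: (measurable_funB (f := cst (F (r l)))) => //.
    apply: (measurable_funM (f := cst L)) => //.
    (* [measurable_sum] wants every summand measurable, while [y] is known to be so only on [s];
       hence the cut-off. *)
    pose h i w : R := if i \in s then Num.max 0 (r l i - y w i) else 0.
    suff -> : (fun w => \sum_(i <- s) Num.max 0 (r l i - y w i)) =
              (fun w : T => \sum_(i <- s) h i w).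
      apply: measurable_sum => i; rewrite /h; case: (boolP (i \in s)) => // si.
      apply: (measurable_maxr (f := cst 0) (g := fun w => r l i - y w i)) => //.
      by apply: (measurable_funB (f := cst (r l i))) => //; exact: my.
    by apply/funext => w; apply: eq_big_seq => i si; rewrite /h si.
  have -> : [set w | a < g l w] = g l @^-1` `]a, +oo[.
    by apply/seteqP; split=> w /=; rewrite in_itv/= andbT.
  by rewrite -[X in measurable X]setTI; exact: mg.
apply/seteqP; split=> w /=; rewrite in_itv/= andbT.
  move=> aF.
  (* Moving every coordinate of [s] down by at most [dl] must not push [F] to [a] or below. The
     summand [1] in the witness covers the case where [L] times the size of [s] is [0]. *)
  have [dl [dl0 hdl]] : exists dl : R, 0 < dl /\ L * ((size s)%:R * dl) < F (y w) - a.
    have [L0 _] := hF; have p : 0 < L * (size s)%:R + 1.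
      by rewrite ltr_wpDl// mulr_ge0.
    exists ((F (y w) - a) / (L * (size s)%:R + 1)); split.
      by rewrite divr_gt0// subr_gt0.
    rewrite mulrA mulrA ltr_pdivrMr// mulrC ltr_pM2l ?subr_gt0//.
    by rewrite ltrDl.
  (* The rationals are taken below [y w], which makes the penalty in [g] vanish. *)
  have /choice[p hp] : forall i, exists p : rat, ratr p \in `]y w i - dl, y w i[.
    by move=> i; apply: rat_in_itvoo; rewrite ltrBlDr ltrDl.
  exists [seq p i | i <- s] => //=.
  have rE i : i \in s -> r [seq p i | i <- s] i = ratr (p i).
    by move=> si; rewrite /r (nth_map i) ?index_mem// nth_index.
  rewrite /g [X in _ - L * X]big_seq [X in _ - L * X]big1 ?mulr0 ?subr0; last first.
    move=> i si; apply/max_idPl; rewrite subr_le0 rE// ltW//.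
    by have := hp i; rewrite in_itv/= => /andP[].
  rewrite -subr_gt0; have := hF.2 (y w) (r [seq p i | i <- s]).
  have : \sum_(i <- s) Num.max 0 (y w i - r [seq p i | i <- s] i) <= (size s)%:R * dl.
    rewrite big_seq (le_trans (ler_sum (G := fun=> dl) _ _))//.
      move=> i si; rewrite ge_max (ltW dl0)/= rE//.
      by have := hp i; rewrite in_itv/= => /andP[h1 h2]; lra.
    by rewrite -big_seq big_const_seq count_predT iter_addr_0 mulr_natl.
  move=> /(ler_wpM2l hF.1); lra.
move=> [l _] /= /lt_le_trans; apply; rewrite /g lerBlDr -lerBlDl.
exact: hF.2.
Qed.

End one_sided_lipschitz.

(** * Expectations and covariances of bounded functions *)

Section bounded_expectation.
Context (R : realType) d (T : measurableType d) (P : probability T R).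
Implicit Types u v : T -> R.

Lemma bounded_integrable u (C : R) : measurable_fun [set: T] u ->
  (forall w, `|u w| <= C) -> P.-integrable [set: T] (EFin \o u).
Proof.
move=> mu uC; apply: measurable_bounded_integrable => //.
  by rewrite [X in (X < _)%E](@probability_setT _ _ _ P) ltry.
by exists C; split => [|x Cx w _]; [exact: num_real|exact: le_trans (uC w) (ltW Cx)].
Qed.

Lemma bounded_expectationE u (C : R) : measurable_fun [set: T] u ->
  (forall w, `|u w| <= C) -> (\int[P]_w (u w)%:E)%E = (\int[P]_w u w)%:E.
Proof.
move=> mu uC; rewrite /Rintegral fineK//.
by have /integrable_fin_num := bounded_integrable mu uC; apply.
Qed.

Lemma bounded_expectation_le u v (C C' : R) : measurable_fun [set: T] u ->
  measurable_fun [set: T] v ->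
  (forall w, `|u w| <= C) -> (forall w, `|v w| <= C') ->
  (forall w, u w <= v w) -> \int[P]_w u w <= \int[P]_w v w.
Proof.
move=> mu mv uC vC uv; apply: le_Rintegral => //.
  exact: bounded_integrable uC.
exact: bounded_integrable vC.
Qed.

Lemma Rintegral_prob_cst c : \int[P]_w c = c.
Proof. by rewrite Rintegral_cst// [X in fine X](@probability_setT _ _ _ P) mulr1. Qed.

Lemma expectation_norm_le u (C : R) : measurable_fun [set: T] u ->
  (forall w, `|u w| <= C) -> `|\int[P]_w u w| <= C.
Proof.
move=> mu uC.
have mn : measurable_fun [set: T] (fun w => `|u w|) by exact: measurableT_comp.
apply: (le_trans (le_normr_Rintegral _ _)) => //.
  exact: bounded_integrable uC.
rewrite -[leRHS]Rintegral_prob_cst; apply: (@bounded_expectation_le _ _ C `|C|) => //.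
by move=> w; rewrite normr_id.
Qed.

Lemma dist_expectation_le u v (C : R) : measurable_fun [set: T] u ->
  measurable_fun [set: T] v ->
  (forall w, `|u w| <= C) -> (forall w, `|v w| <= C) ->
  `|\int[P]_w u w - \int[P]_w v w| <= \int[P]_w `|u w - v w|.
Proof.
move=> mu mv uC vC; rewrite -RintegralB//; last 2 first.
- exact: bounded_integrable uC.
- exact: bounded_integrable vC.
apply: le_normr_Rintegral => //.
apply: (@bounded_integrable (fun w => u w - v w) (C + C)).
  exact: measurable_funB.
by move=> w; rewrite (le_trans (ler_normB _ _))// lerD.
Qed.

Lemma dist_measurable u v : measurable_fun [set: T] u ->
  measurable_fun [set: T] v -> measurable_fun [set: T] (fun w => `|u w - v w|).
Proof.
move=> mu mv; apply: measurableT_comp => //; exact: measurable_funB.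
Qed.

Lemma dist_bounded (a b C : R) : `|a| <= C -> `|b| <= C -> `| `|a - b| | <= C + C.
Proof. by move=> aC bC; rewrite normr_id (le_trans (ler_normB _ _))// lerD. Qed.

Lemma expectation_dist_triangle u v (z : T -> R) (C : R) : measurable_fun [set: T] u ->
  measurable_fun [set: T] v -> measurable_fun [set: T] z ->
  (forall w, `|u w| <= C) -> (forall w, `|v w| <= C) -> (forall w, `|z w| <= C) ->
  \int[P]_w `|u w - z w| <= \int[P]_w `|u w - v w| + \int[P]_w `|v w - z w|.
Proof.
move=> mu mv mz uC vC zC.
rewrite -RintegralD//.
- apply: (@bounded_expectation_le _ _ (C + C) ((C + C) + (C + C))).
  + exact: dist_measurable.
  + by apply: measurable_funD; exact: dist_measurable.
  + by move=> w; exact: dist_bounded.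
  + by move=> w; rewrite (le_trans (ler_normD _ _))// lerD// dist_bounded.
  + by move=> w; exact: ler_distD.
- apply: (@bounded_integrable _ (C + C)); first exact: dist_measurable.
  by move=> w; exact: dist_bounded.
- apply: (@bounded_integrable _ (C + C)); first exact: dist_measurable.
  by move=> w; exact: dist_bounded.
Qed.

Lemma bounded_convergence (u_ : nat -> T -> R) u (C : R) :
  (forall n, measurable_fun [set: T] (u_ n)) -> measurable_fun [set: T] u ->
  (forall n w, `|u_ n w| <= C) ->
  (forall w, u_ n w @[n --> \oo] --> u w) ->
  \int[P]_w `|u_ n w - u w| @[n --> \oo] --> 0.
Proof.
move=> mu_ mu uC uu.
have uC' w : `|u w| <= C.
  by apply: (cvgr_to_le (cvg_norm (uu w))); apply: nearW => n; exact: uC.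
have [_ h _] : [/\ P.-integrable [set: T] (EFin \o u),
    (\int[P]_w `|(EFin \o u_ n) w - (EFin \o u) w|)%E @[n --> \oo] --> 0%E &
    (\int[P]_w (EFin \o u_ n) w)%E @[n --> \oo] --> (\int[P]_w (EFin \o u) w)%E].
  apply: (@dominated_convergence _ T R P setT measurableT
    (fun n => EFin \o u_ n) (EFin \o u) (cst C%:E)) => //.
  - by move=> n; exact/measurable_EFinP.
  - exact/measurable_EFinP.
  - by apply: aeW => w _; apply: cvg_EFin; [exact: nearW|exact: uu].
  - exact: (@bounded_integrable (cst C) `|C|).
  - by apply: aeW => w n _ /=; rewrite lee_fin uC.
move: h; rewrite -[0%E]/(0%:E) => /fine_cvgP[_]; apply: cvg_trans.
by apply: near_eq_cvg; near=> n; rewrite /Rintegral.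
Unshelve. all: by end_near. Qed.

(** Among functions bounded by [C] the covariance is Lipschitz in [L^1]: replacing both functions
    within [e'] moves the mean of the product and the product of the means by at most [2 * C * e']
    each. *)
Lemma covariance_sign_limit (sg : R) u v (C : R) : `|sg| <= 1 ->
  measurable_fun [set: T] u -> measurable_fun [set: T] v ->
  (forall w, `|u w| <= C) -> (forall w, `|v w| <= C) ->
  (forall e : R, 0 < e -> exists u' v',
    [/\ measurable_fun [set: T] u', measurable_fun [set: T] v',
       forall w, `|u' w| <= C, forall w, `|v' w| <= C &
    [/\ \int[P]_w `|u w - u' w| <= e, \int[P]_w `|v w - v' w| <= e &
      0 <= sg * (\int[P]_w (u' w * v' w) -
                (\int[P]_w u' w) * (\int[P]_w v' w))]]) ->
  0 <= sg * (\int[P]_w (u w * v w) - (\int[P]_w u w) * (\int[P]_w v w)).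
Proof.
move=> sg1 mu mv uC vC h.
have C0 : 0 <= C by rewrite (le_trans _ (uC point)).
apply/ler_addgt0Pr => e e0.
have [e' [e'0 e'E]] : exists e', 0 < e' /\ 4 * C * e' <= e.
  exists (e / (4 * C + 1)); have p : 0 < 4 * C + 1 by rewrite ltr_wpDl// mulr_ge0.
  split; first exact: divr_gt0.
  by rewrite mulrA ler_pdivrMr// mulrC ler_pM2l// lerDl.
have [u' [v' [mu' mv' uC' vC' [hu hv hs]]]] := h e' e'0.
have mM (x y : T -> R) : measurable_fun [set: T] x -> measurable_fun [set: T] y ->
  measurable_fun [set: T] (fun w => x w * y w) by exact: measurable_funM.
have bM (x y : R) : `|x| <= C -> `|y| <= C -> `|x * y| <= C * C.
  by move=> xC yC; rewrite normrM ler_pM.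
have h1 : `|\int[P]_w (u w * v w) - \int[P]_w (u' w * v' w)| <= 2 * C * e'.
  apply: (le_trans (@dist_expectation_le _ _ (C * C) _ _ _ _)); first exact: mM.
  - exact: mM.
  - by move=> w; exact: bM.
  - by move=> w; exact: bM.
  apply: (@le_trans _ _ (\int[P]_w (C * `|u w - u' w| + C * `|v w - v' w|))).
    apply: (@bounded_expectation_le _ _ (C * C + C * C) (C * (C + C) + C * (C + C))).
    - by apply: dist_measurable; exact: mM.
    - by apply: measurable_funD; apply: measurable_funM => //; exact: dist_measurable.
    - by move=> w; apply: dist_bounded; exact: bM.
    - move=> w; rewrite (le_trans (ler_normD _ _))// lerD// normrM ger0_norm// ler_wpM2l//.
      exact: dist_bounded.
      exact: dist_bounded.
    - move=> w; rewrite (_ : _ - _ = (u w - u' w) * v w + u' w * (v w - v' w)); last by ring.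
      rewrite (le_trans (ler_normD _ _))// !normrM lerD//.
        by rewrite mulrC ler_wpM2r.
      by rewrite ler_wpM2r.
  have mdu : P.-integrable [set: T] (EFin \o (fun w => `|u w - u' w|)).
    by apply: (@bounded_integrable _ (C + C)); [exact: dist_measurable|move=> w; exact: dist_bounded].
  have mdv : P.-integrable [set: T] (EFin \o (fun w => `|v w - v' w|)).
    by apply: (@bounded_integrable _ (C + C)); [exact: dist_measurable|move=> w; exact: dist_bounded].
  rewrite RintegralD//; last 2 first.
  - apply: (@bounded_integrable _ (C * (C + C))).
      by apply: measurable_funM => //; exact: dist_measurable.
    by move=> w; rewrite normrM ger0_norm// ler_wpM2l// dist_bounded.
  - apply: (@bounded_integrable _ (C * (C + C))).
      by apply: measurable_funM => //; exact: dist_measurable.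
    by move=> w; rewrite normrM ger0_norm// ler_wpM2l// dist_bounded.
  rewrite !RintegralZl//.
  rewrite (_ : 2 * C * e' = C * e' + C * e'); last by ring.
  by rewrite lerD// ler_wpM2l.
have h2 : `|(\int[P]_w u w) * (\int[P]_w v w) -
    (\int[P]_w u' w) * (\int[P]_w v' w)| <= 2 * C * e'.
  set a := \int[P]_w u w; set b := \int[P]_w v w.
  set a' := \int[P]_w u' w; set b' := \int[P]_w v' w.
  rewrite (_ : _ - _ = (a - a') * b + a' * (b - b')); last by ring.
  rewrite (_ : 2 * C * e' = e' * C + C * e'); last by ring.
  rewrite (le_trans (ler_normD _ _))// !normrM lerD// ler_pM//.
  - exact: le_trans (dist_expectation_le _ _ uC uC') hu.
  - exact: expectation_norm_le.
  - exact: expectation_norm_le.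
  - exact: le_trans (dist_expectation_le _ _ vC vC') hv.
move: hs h1 h2; set A := \int[P]_w (u w * v w); set A' := \int[P]_w (u' w * v' w).
set B := (\int[P]_w u w) * (\int[P]_w v w).
set B' := (\int[P]_w u' w) * (\int[P]_w v' w) => hs h1 h2.
have : `|sg * (A' - B') - sg * (A - B)| <= 4 * C * e'.
  rewrite -mulrBr normrM -[leRHS]mul1r ler_pM//.
  rewrite (_ : A' - B' - (A - B) = (B - B') - (A - A')); last by ring.
  rewrite (le_trans (ler_normB _ _))//.
  rewrite (_ : 4 * C * e' = 2 * C * e' + 2 * C * e'); last by ring.
  exact: lerD h2 h1.
by move=> /(le_trans (ler_norm _)); lra.
Qed.

End bounded_expectation.

(** * Finitely additive set functions below a finite measure *)

Section dominated_contents.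
Context (R : realType) d (T : measurableType d).

(** Only finite additivity is required, because these three clauses survive pointwise limits, which
    countable additivity by itself does not along an ultrafilter. *)
Definition dominated_content (m : {measure set T -> \bar R}) (lam : set T -> R) :=
  [/\ forall A, measurable A -> 0 <= lam A,
      forall A, measurable A -> lam A <= fine (m A) &
      forall A B, measurable A -> measurable B -> A `&` B = set0 ->
        lam (A `|` B) = lam A + lam B].

(* Continuity at the empty set is inherited from the dominating finite measure. *)
Lemma dominated_content_measure (m : {measure set T -> \bar R}) lam :
  (m setT < +oo)%E -> dominated_content m lam ->
  exists nu : {measure set T -> \bar R}, forall A, measurable A -> nu A = (lam A)%:E.
Proof.
move=> mfin [lam_ge0 lam_le lamU].
have mf A : measurable A -> m A \is a fin_num.
  move=> mA; rewrite ge0_fin_numE//; apply: le_lt_trans mfin.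
  by apply: le_measure; rewrite ?inE.
have lam0 : lam set0 = 0.
  by apply/eqP; rewrite eq_le lam_ge0// andbT (le_trans (lam_le _ _))// measure0.
(* The value [0] off the measurable sets is a filler: a measure is a total function, nonnegative on
   every set. *)
pose mu (A : set T) : \bar R := if pselect (measurable A) then (lam A)%:E else 0%E.
have muE A : measurable A -> mu A = (lam A)%:E by rewrite /mu; case: pselect.
have mu0 : mu set0 = 0%E by rewrite muE// lam0.
have mu_ge0 A : (0 <= mu A)%E.
  by rewrite /mu; case: pselect => // mA; rewrite lee_fin lam_ge0.
have mu_sigma : semi_sigma_additive mu.
  move=> F mF tF mUF.
  have mBig n : measurable (\big[setU/set0]_(i < n) F i) by exact: bigsetU_measurable.
  pose W n := \bigcup_i F i `\` \big[setU/set0]_(i < n) F i.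
  have mW n : measurable (W n) by exact: measurableD.
  have big_lam n : lam (\big[setU/set0]_(i < n) F i) = \sum_(i < n) lam (F i).
    elim: n => [|n IH]; first by rewrite !big_ord0.
    rewrite !big_ord_recr/= lamU// ?IH//.
      exact: mBig.
    rewrite -subset0 -bigcup_mkord => x [[i /= ilt Fi] Fn].
    have := tF i n I I; rewrite -/(_ !=set0) => h.
    by move: ilt; rewrite h ?ltnn//; exists x.
  (* By finite additivity the partial sums miss the union by exactly [lam (W n)], which is squeezed
     between [0] and [m (W n)]. *)
  have muW n : (\sum_(0 <= i < n) mu (F i) = (lam (\bigcup_i F i) - lam (W n))%:E)%E.
    rewrite big_mkord (eq_bigr (fun i : 'I_n => (lam (F i))%:E)); last first.
      by move=> i _; exact: muE.
    rewrite sumEFin -big_lam; congr EFin; apply/eqP; rewrite eq_sym subr_eq -lamU//.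
      by apply/eqP; congr lam; rewrite /W setDUK// => x; rewrite -bigcup_mkord => -[i _ ?]; exists i.
    by rewrite /W setDIK.
  rewrite (_ : (fun n => _) = fun n => (lam (\bigcup_i F i) - lam (W n))%:E); last first.
    by apply/funext => n; exact: muW.
  rewrite muE//; apply: cvg_EFin; first exact: nearW.
  rewrite -[X in _ --> X]subr0; apply: cvgB; first exact: cvg_cst.
  have W0 : \bigcap_n W n = set0.
    rewrite -subset0 => x hx; have [[i _ Fix] _] := hx 0%N I.
    by have [_] := hx i.+1 I; apply; rewrite big_ord_recr/=; right.
  have hW : fine (m (W n)) @[n --> \oo] --> 0.
    have : (m \o W) n @[n --> \oo] --> m (\bigcap_n W n).
      apply: nonincreasing_cvg_mu => //.
      - by rewrite -ge0_fin_numE// mf.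
      - by rewrite W0.
      - by move=> n k nk; apply/subsetPset; apply: setDS; exact: subset_bigsetU.
    by rewrite W0 measure0 => /fine_cvgP[].
  apply: (squeeze_cvgr _ (cvg_cst 0) hW).
  by apply: nearW => n; rewrite lam_ge0//= lam_le.
pose nu : {measure set T -> \bar R} :=
  HB.pack mu (isMeasure.Build _ _ _ mu mu0 mu_ge0 mu_sigma).
by exists nu.
Qed.

(** Each [th n A] stays in the compact interval from [0] to [m A], so [U] yields a limit at all
    measurable [A] at once, with no diagonal extraction over an uncountable family of sets. *)
Lemma ultralimit_dominated_content (U : set_system nat) (UU : UltraFilter U)
    (m : {measure set T -> \bar R}) (th : nat -> set T -> R) :
  (m setT < +oo)%E -> (forall n, dominated_content m (th n)) ->
  exists2 nu : {measure set T -> \bar R},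
    forall A, measurable A -> th n A @[n --> U] --> fine (nu A) &
    forall A, measurable A -> (nu A <= m A)%E.
Proof.
move=> mfin hth.
have mf A : measurable A -> m A \is a fin_num.
  move=> mA; rewrite ge0_fin_numE//; apply: le_lt_trans mfin.
  by apply: le_measure; rewrite ?inE.
have PU : ProperFilter U by exact: ultra_proper.
have cth A : measurable A -> cvg (th n A @[n --> U]).
  move=> mA; have UF : UltraFilter (th n A @[n --> U]).
    split; first exact: fmap_proper_filter.
    move=> G PG sG; apply/seteqP; split => // B GB.
    have [//|UB] := in_ultra_setVsetC ((fun n => th n A) @^-1` B) UU.
    exfalso; have : G (B `&` ~` B) by apply: filterI => //; apply: sG.
    by rewrite setICr; exact: filter_not_empty.
  have := @segment_compact R 0 (fine (m A)); rewrite compact_ultra.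
  move=> /(_ _ UF)[|x [_ xU]]; last by apply/cvg_ex; exists x.
  apply: nearW => n; have [h1 h2 _] := hth n.
  by rewrite /= in_itv/= h1// h2.
pose lam A := lim (th n A @[n --> U]).
have dlam : dominated_content m lam.
  split=> [A mA|A mA|A B mA mB AB].
  - apply: limr_ge; first exact: cth.
    by apply: nearW => n; have [h _ _] := hth n; exact: h.
  - apply: limr_le; first exact: cth.
    by apply: nearW => n; have [_ h _] := hth n; exact: h.
  - rewrite /lam -limD; [|exact: cth..].
    congr (lim (_ @ U)); apply/funext => n.
    by have [_ _ h] := hth n; exact: h.
have [nu nuE] := dominated_content_measure mfin dlam.
exists nu => A mA; rewrite nuE//; first exact: cth.
by rewrite -(fineK (mf _ mA)) lee_fin; have [_ h _] := dlam; exact: h.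
Qed.

End dominated_contents.

(** * Setwise limits of almost dominated measures *)

Section dominated_limits.
Context (R : realType) d (T : measurableType d).

Lemma additive_partition (J : finType) (f : T -> J) (lam : set T -> R) A :
  (forall j, measurable (f @^-1` [set j])) -> lam set0 = 0 ->
  (forall B C, measurable B -> measurable C -> B `&` C = set0 ->
    lam (B `|` C) = lam B + lam C) ->
  measurable A -> lam A = \sum_j lam (A `&` f @^-1` [set j]).
Proof.
move=> mf lam0 lamU mA.
have h (s : seq J) : uniq s ->
    measurable (A `&` [set x | f x \in s]) /\
    lam (A `&` [set x | f x \in s]) = \sum_(j <- s) lam (A `&` f @^-1` [set j]).
  elim: s => [_|j s IH /= /andP[js us]].
    rewrite big_nil (_ : [set x | _] = set0) ?setI0//.
    by apply/seteqP; split.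
  have [ms IHs] := IH us.
  have -> : A `&` [set x | f x \in j :: s] =
      (A `&` f @^-1` [set j]) `|` (A `&` [set x | f x \in s]).
    rewrite -setIUr; congr (_ `&` _); apply/seteqP; split=> x /=; rewrite inE.
      by move=> /orP[/eqP|]; [left|right].
    by move=> [->|->]; rewrite ?eqxx ?orbT.
  have mj : measurable (A `&` f @^-1` [set j]) by exact: measurableI.
  split; first exact: measurableU.
  rewrite big_cons lamU// ?IHs//.
  rewrite -subset0 => x [[_ /= fx] [_ /=]]; rewrite fx => js'.
  by rewrite js' in js.
have [_] := h (enum J) (enum_uniq _).
rewrite big_enum/= => <-; congr lam; rewrite -[LHS]setIT; congr (_ `&` _).
by apply/seteqP; split => x //= _; rewrite mem_enum.
Qed.

Variable C : (set T)^nat.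
Hypothesis mC : forall n, measurable (C n).

(** Its fibres are the atoms, possibly empty, of the field generated by the first [n] sets [C i]. *)
Definition coding n (x : T) : {ffun 'I_n -> bool} := [ffun i : 'I_n => `[< C i x >]].

Definition atom n (t : {ffun 'I_n -> bool}) : set T := coding n @^-1` [set t].

Lemma atom_measurable n t : measurable (@atom n t).
Proof.
have -> : atom t = \bigcap_(i in [set: 'I_n]) (if t i then C i else ~` C i).
  apply/seteqP; split=> x.
    by move=> /= <- i _; rewrite ffunE; case: ifPn => /asboolP.
  move=> h; apply/ffunP => i; rewrite ffunE; have := h i I.
  case: (t i) => ?; first exact/asboolP.
  by apply/negbTE/asboolP.
apply: fin_bigcap_measurable; first exact: finite_finset.
by move=> i _; case: (t i); [exact: mC|apply: measurableC; exact: mC].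
Qed.

Lemma setI_atom n (t : {ffun 'I_n -> bool}) (i : 'I_n) :
  C i `&` atom t = if t i then atom t else set0.
Proof.
case: ifPn => ti; apply/seteqP; split=> x //=.
- by move=> [].
- by move=> h; split => //; move: ti; rewrite -h ffunE => /asboolP.
- by move=> [Cx h]; move: ti; rewrite -h ffunE => /negP; apply; exact/asboolP.
Qed.

Section clipped_density.
Variables (S : set T) (mS : measurable S) (mu nu : {measure set T -> \bar R}).
Hypothesis muS : (mu S < +oo)%E.
Hypothesis nuS : (nu S < +oo)%E.

Let fin_I (m : {measure set T -> \bar R}) A : (m S < +oo)%E -> measurable A ->
  m (S `&` A) \is a fin_num.
Proof.
move=> mfin mA; rewrite ge0_fin_numE//; apply: le_lt_trans mfin.
by apply: le_measure; rewrite ?inE//; exact: measurableI.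
Qed.

Let fineU (m : {measure set T -> \bar R}) : (m S < +oo)%E ->
  forall A B, measurable A -> measurable B -> A `&` B = set0 ->
  fine (m (S `&` (A `|` B))) = fine (m (S `&` A)) + fine (m (S `&` B)).
Proof.
move=> mfin A B mA mB AB; rewrite setIUr measureU//.
- by rewrite fineD// fin_I.
- exact: measurableI.
- exact: measurableI.
- by rewrite setIACA setIid AB setI0.
Qed.

Let le_fine (m : {measure set T -> \bar R}) A B : (m S < +oo)%E ->
  measurable A -> measurable B -> A `<=` B ->
  fine (m (S `&` A)) <= fine (m (S `&` B)).
Proof.
move=> mfin mA mB AB; apply: fine_le; [exact: fin_I..|].
by apply: le_measure; rewrite ?inE; [exact: measurableI..|exact: setIS].
Qed.

(* The density of [nu] with respect to [mu] on the level-[n] atoms, clipped at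
   [1] so that the resulting content is dominated by [mu]. *)
Definition clipped n (A : set T) : R := \sum_t
  Num.min 1 (fine (nu (S `&` @atom n t)) / fine (mu (S `&` atom t))) *
    fine (mu (S `&` (A `&` atom t))).

Lemma clipped_dominated n : dominated_content (mrestr mu mS) (clipped n).
Proof.
have r0 t : 0 <= Num.min 1 (fine (nu (S `&` @atom n t)) / fine (mu (S `&` atom t))).
  by rewrite le_min ler01/= divr_ge0.
split => [A mA|A mA|A B mA mB AB].
- by apply: sumr_ge0 => t _; rewrite mulr_ge0.
- rewrite /= /mrestr setIC (additive_partition (f := coding n)
    (lam := fun A => fine (mu (S `&` A))))//.
  + apply: ler_sum => t _; by rewrite -[leRHS]mul1r ler_wpM2r // ge_min lexx.
  + exact: atom_measurable.
  + by rewrite setI0 measure0.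
  + exact: fineU.
- rewrite -big_split/=; apply: eq_bigr => t _; rewrite -mulrDr; congr (_ * _).
  have mt := atom_measurable t.
  rewrite setIUl fineU//; [exact: measurableI..|].
  by rewrite setIACA AB set0I.
Qed.

(** Since [i < n], the set [C i] is a union of level-[n] atoms. On an atom with mass [a] for [nu]
    and [b] for [mu], clipping turns [a] into the minimum of [a] and [b], an error of
    [(a - b)^+]. *)
Lemma clipped_dist n (i : 'I_n) :
  `|fine (nu (S `&` C i)) - clipped n (S `&` C i)| <=
  \sum_t Num.max 0 (fine (nu (S `&` @atom n t)) - fine (mu (S `&` atom t))).
Proof.
rewrite (additive_partition (f := coding n) (lam := fun A => fine (nu (S `&` A))))//.
- rewrite /clipped -sumrB (le_trans (ler_norm_sum _ _ _))//; apply: ler_sum => t _.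
  rewrite -/(atom t) -setIA setI_atom; case: ifPn => ti; last first.
    by rewrite !setI0 !measure0/= mulr0 subr0 normr0 le_max lexx.
  rewrite setIA setIid.
  set a := fine (nu _); set b := fine (mu _).
  have a0 : 0 <= a by rewrite fine_ge0.
  have b0 : 0 <= b by rewrite fine_ge0.
  (* On a [mu]-null atom the clipped mass is [0], whatever the quotient, and all of [a] is counted
     on the right. *)
  have [->|bn0] := eqVneq b 0.
    by rewrite mulr0 !subr0 ger0_norm// le_max lexx orbT.
  have bp : 0 < b by rewrite lt_neqAle eq_sym bn0.
  have [ab|ba] := leP a b.
    rewrite min_r ?ler_pdivrMr ?mul1r// divfK// subrr normr0.
    by rewrite le_max lexx.
  have ba' := ltW ba.
  rewrite min_l ?ler_pdivlMr ?mul1r// ger0_norm ?subr_ge0//.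
  by rewrite le_max lexx orbT.
- exact: atom_measurable.
- by rewrite setI0 measure0.
- exact: fineU.
Qed.

End clipped_density.

Definition cell (S_ : (set T)^nat) n (p : 'I_n * {ffun 'I_n -> bool}) : set T :=
  S_ p.1 `&` atom p.2.

(** On each [S_ j], where [mu] is finite, the clipped contents have an ultralimit [la j] below [mu],
    and these are summed over [j]. The gap hypothesis makes the effect of clipping vanish along [U],
    so the original masses have the same limits. *)
Lemma dominated_limit_measure (S_ : (set T)^nat) (U : set_system nat)
    (mu : {measure set T -> \bar R}) (nu_ : nat -> {measure set T -> \bar R}) :
  (forall j, measurable (S_ j)) -> trivIset setT S_ -> \bigcup_j S_ j = setT ->
  UltraFilter U -> \oo `<=` U ->
  (forall j, mu (S_ j) < +oo)%E -> (forall n j, nu_ n (S_ j) < +oo)%E ->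
  (forall e : R, 0 < e -> \forall n \near U, \sum_(p : 'I_n * {ffun 'I_n -> bool})
    Num.max 0 (fine (nu_ n (cell S_ p)) - fine (mu (cell S_ p))) <= e) ->
  exists2 nu : {measure set T -> \bar R},
    forall A, measurable A -> (nu A <= mu A)%E &
    forall j i, fine (nu_ n (S_ j `&` C i)) @[n --> U] --> fine (nu (S_ j `&` C i)).
Proof.
move=> mS tS SU UU ooU muS nuS gap.
have PU : ProperFilter U by exact: ultra_proper.
have /choice[la hla] : forall j, exists la : {measure set T -> \bar R},
    (forall A, measurable A ->
       clipped (S_ j) mu (nu_ n) n A @[n --> U] --> fine (la A)) /\
    (forall A, measurable A -> (la A <= mu (A `&` S_ j))%E).
  move=> j; have mfin : (mrestr mu (mS j) setT < +oo)%E by rewrite /mrestr setTI.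
  have hth n : dominated_content (mrestr mu (mS j)) (clipped (S_ j) mu (nu_ n) n).
    exact: clipped_dominated.
  have [la h1 h2] := ultralimit_dominated_content UU (m := mrestr mu (mS j)) mfin hth.
  by exists la.
(* [la j] lives on [S_ j], so on a subset of [S_ j] the series [nu] has a single nonzero term. *)
have laE j A : measurable A -> A `&` S_ j = set0 -> la j A = 0%E.
  move=> mA AS; apply/eqP; rewrite eq_le measure_ge0 andbT.
  by rewrite (le_trans ((hla j).2 _ mA))// AS measure0.
pose nu : {measure set T -> \bar R} := mseries la 0.
exists nu => [A mA|j i].
  have -> : mu A = (\sum_(0 <= j <oo) mu (A `&` S_ j))%E.
    rewrite -[in LHS](setIT A) -SU setI_bigcupr measure_semi_bigcup//.
    - by move=> j; exact: measurableI.
    - exact: trivIset_setIl.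
    - by rewrite -setI_bigcupr SU setIT.
  by apply: lee_nneseries => // j _; exact: (hla j).2.
have mSC : measurable (S_ j `&` C i) by exact: measurableI.
have -> : nu (S_ j `&` C i) = la j (S_ j `&` C i).
  rewrite /nu/= /mseries.
  rewrite (@nneseriesD1 _ _ j)// eseries0 ?adde0// => k _ /= kj.
  apply: laE => //; rewrite setIAC.
  suff -> : S_ j `&` S_ k = set0 by rewrite set0I.
  by apply/eqP/negPn/negP => /set0P /(tS _ _ I I) jk; rewrite jk eqxx in kj.
have h1 := (hla j).1 _ mSC.
rewrite -[X in _ --> X](addr0) .
rewrite (_ : (fun n => _) = (fun n => clipped (S_ j) mu (nu_ n) n (S_ j `&` C i) +
  (fine (nu_ n (S_ j `&` C i)) - clipped (S_ j) mu (nu_ n) n (S_ j `&` C i)))); last first.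
  by apply/funext => n; rewrite addrC subrK.
apply: cvgD => //.
apply/cvgrPdist_le => e e0; near=> n.
rewrite sub0r normrN.
(* The level must exceed both indices: [i] for [C i] to be a union of atoms, [j] for the cells of
   [S_ j] to occur in the gap sum. *)
have jn : (j < n)%N by near: n; apply: ooU; exact: nbhs_infty_gt.
have in_ : (i < n)%N by near: n; apply: ooU; exact: nbhs_infty_gt.
have := clipped_dist (mS j) mu (nuS n j) (Ordinal in_).
move=> /le_trans; apply.
apply: (@le_trans _ _ (\sum_(p : 'I_n * {ffun 'I_n -> bool})
    Num.max 0 (fine (nu_ n (cell S_ p)) - fine (mu (cell S_ p))))); last first.
  by near: n; exact: gap.
rewrite -(pair_big xpredT xpredT (fun (k : 'I_n) t =>
  Num.max 0 (fine (nu_ n (S_ k `&` atom t)) - fine (mu (S_ k `&` atom t)))))/=.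
rewrite [leRHS](bigD1 (Ordinal jn))//= lerDl.
by apply: sumr_ge0 => k _; apply: sumr_ge0 => t _; rewrite le_max lexx.
Unshelve. all: by end_near. Qed.

End dominated_limits.

(** * The measurable space of measures *)

Section space_of_measures.
Context (R : realType) (S : completePseudoMetricType R).
Local Notation MS := (MS S).
Local Notation borelS := (borelS S).

Lemma open_borel (A : set S) : open A -> measurable (A : set borelS).
Proof. exact: sub_sigma_algebra. Qed.

Lemma closed_borel (A : set S) : closed A -> measurable (A : set borelS).
Proof.
by move=> cA; rewrite -[A]setCK; apply: measurableC; apply: open_borel; exact: closed_openC.
Qed.

(** Unit balls around a countable dense set cover [S] and are made disjoint. Interiors are taken
    because a ball of the pseudometric structure is not known to be open; [f] numbers the dense
    points without assuming that there are infinitely many. *)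
Lemma bounded_partition : polish_space S -> exists S_ : (set borelS)^nat,
  [/\ forall j, measurable (S_ j), forall j, mbounded (S_ j),
      trivIset setT S_ & \bigcup_j S_ j = setT].
Proof.
move=> [_ [D [/countable_injP[f finj] dD]]].
pose O_ j : set borelS := \bigcup_(x in [set x | D x /\ f x = j]) (ball x 1)^°.
have mO j : measurable (O_ j).
  by apply: open_borel; apply: bigcup_open => x _; exact: open_interior.
exists (seqDU O_); split.
- by move=> j; apply: measurableD => //; exact: bigsetU_measurable.
- move=> j; have [[x [Dx fx]]|nx] := pselect (exists x, D x /\ f x = j).
    exists x, 1 => y [[z [Dz fz]] /= /interior_subset zy _].
    suff -> : x = z by [].
    by apply: finj; rewrite ?inE// fx fz.
  by exists point, 1 => y [[z ? _] _]; exfalso; apply: nx; exists z.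
- exact: trivIset_seqDU.
- rewrite -seqDU_bigcup_eq; apply/seteqP; split => // y _.
  (* With radius one half, the whole ball around [y] falls into the unit ball around any dense point
     found in it, so [y] is interior to the latter. *)
  have ynbh : nbhs y (ball y (2^-1 : R)) by apply: nbhsx_ballx; rewrite invr_gt0.
  have [x [xb Dx]] : (ball y (2^-1 : R))^° `&` D !=set0.
    by apply: dD; [exists y; exact: ynbh|exact: open_interior].
  exists (f x) => //; exists x => //=.
  rewrite /interior /=; apply: filterS ynbh => z yz.
  have -> : 1 = 2^-1 + 2^-1 :> R by rewrite [LHS]splitr div1r.
  by apply: ball_triangle yz; apply: ball_sym; exact: interior_subset xb.
Qed.

Definition measures := MS.
HB.instance Definition _ := gen_eqMixin measures.
HB.instance Definition _ := gen_choiceMixin measures.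
HB.instance Definition _ := isPointed.Build measures (mzero : MS).

(* [MS_measurable] is a sigma-algebra on [locfin]; its extension to all
   measures makes the library's theory of measurable functions available. *)
Definition locfin_trace : set (set measures) :=
  [set X | MS_measurable (@locfin R S `&` X)].

Definition measurable_measures := g_sigma_algebraType locfin_trace.

(** The trace class is already a sigma-algebra, so generating adds no set. *)
Lemma measurable_measuresE (X : set measurable_measures) :
  measurable X = MS_measurable (@locfin R S `&` X).
Proof.
suff h : sigma_algebra setT locfin_trace.
  by rewrite (measurable_g_measurableTypeE h).
split.
- by rewrite /locfin_trace/= setI0; exact: sigma_algebra0.
- move=> A hA; rewrite /locfin_trace/= setTD -setDE.
  rewrite (_ : _ `\` A = @locfin R S `\` (@locfin R S `&` A)).
    exact: sigma_algebraCD.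
  by rewrite setDIr setDv set0U.
- move=> F hF; rewrite /locfin_trace/= setI_bigcupr.
  exact: sigma_algebra_bigcup.
Qed.

Lemma locfin_measurable : measurable (@locfin R S : set measurable_measures).
Proof.
rewrite measurable_measuresE setIid -[X in MS_measurable X]setD0.
by apply: sigma_algebraCD; exact: sigma_algebra0.
Qed.

Lemma eval_measurable (B : set borelS) : measurable B ->
  measurable_fun setT (fun mu : measurable_measures => (mu : MS) B).
Proof.
move=> mB _ E mE; rewrite setTI measurable_measuresE.
by apply: sub_sigma_algebra; exists B, E.
Qed.

Lemma random_measure_measurable d (Om : measurableType d) (N : Om -> MS) :
  random_measure N -> measurable_fun setT (N : Om -> measurable_measures).
Proof.
move=> [lN mN] _ X mX; rewrite setTI.
rewrite (_ : N @^-1` X = N @^-1` (@locfin R S `&` X)).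
  by apply: mN; rewrite -measurable_measuresE.
by apply/seteqP; split => w //= [].
Qed.

End space_of_measures.

(** * Closed families of measures and inner regularity of laws *)

Section closed_families.
Context (R : realType) (S : completePseudoMetricType R).
Local Notation MS := (MS S).
Local Notation borelS := (borelS S).
Local Notation measurable_measures := (measurable_measures S).
Variable S_ : (set borelS)^nat.
Hypothesis mS : forall j, measurable (S_ j).
Hypothesis bS : forall j, mbounded (S_ j).
Hypothesis tS : trivIset setT S_.
Hypothesis SU : \bigcup_j S_ j = setT.

(* Closedness for setwise convergence on countably many sets [S_ j `&` C i],
   along ultrafilters so that finite unions remain closed. *)
Definition countably_closed (K : set measurable_measures) :=
  exists C : (set borelS)^nat, (forall i, measurable (C i)) /\
  forall (U : set_system nat) (nu_ : nat -> MS) (nu : MS), UltraFilter U ->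
    (\forall n \near U, K (nu_ n) /\ locfin (nu_ n)) -> locfin nu ->
    (forall j i, fine (nu_ n (S_ j `&` C i)) @[n --> U] -->
                 fine (nu (S_ j `&` C i))) ->
    K nu.

(** Lets sums and products of index types name the test sets; numbers that code no index receive the
    empty set. *)
Lemma countably_closed_countType (I : countType) (C : I -> set borelS) K :
  (forall i, measurable (C i)) ->
  (forall (U : set_system nat) (nu_ : nat -> MS) (nu : MS), UltraFilter U ->
    (\forall n \near U, K (nu_ n) /\ locfin (nu_ n)) -> locfin nu ->
    (forall j i, fine (nu_ n (S_ j `&` C i)) @[n --> U] -->
                 fine (nu (S_ j `&` C i))) ->
    K nu) -> countably_closed K.
Proof.
move=> mC hK; exists (fun n => if unpickle n is Some i then C i else set0).
split => [n|U nu_ nu UU Unu lnu cnu]; first by case: (unpickle n).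
apply: (hK U nu_) => // j i.
by have := cnu j (pickle i); rewrite pickleK.
Qed.

Definition closed_family (K : set measurable_measures) :=
  measurable K /\ countably_closed K.

Lemma closed_family0 : closed_family set0.
Proof.
split => //; apply: (@countably_closed_countType void (fun=> set0)) => //.
move=> U nu_ nu UU Unu; exfalso.
have PU : ProperFilter U by exact: ultra_proper.
by have /filter_ex[n []] := Unu.
Qed.

Lemma closed_familyT : closed_family setT.
Proof. by split => //; exact: (@countably_closed_countType void (fun=> set0)). Qed.

Lemma closed_family_locfin : closed_family (@locfin R S).
Proof.
split; first exact: locfin_measurable.
exact: (@countably_closed_countType void (fun=> set0)).
Qed.

Lemma closed_family_locfinC : closed_family (~` (@locfin R S)).
Proof.
split; first by apply: measurableC; exact: locfin_measurable.
apply: (@countably_closed_countType void (fun=> set0)) => //.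
move=> U nu_ nu UU Unu; exfalso.
have PU : ProperFilter U by exact: ultra_proper.
by have /filter_ex[n []] := Unu.
Qed.

Lemma closed_familyU K K' : closed_family K -> closed_family K' ->
  closed_family (K `|` K').
Proof.
move=> [mK [C [mC hK]]] [mK' [C' [mC' hK']]]; split; first exact: measurableU.
apply: (@countably_closed_countType (nat + nat)%type
  (fun i => match i with inl i => C i | inr i => C' i end)).
  by case.
move=> U nu_ nu UU Unu lnu cnu.
have PU : ProperFilter U by exact: ultra_proper.
have [UK|UK] := in_ultra_setVsetC (nu_ @^-1` K) UU.
  left; apply: (hK U nu_) => //; last by move=> j i; exact: (cnu j (inl i)).
  by apply: filterS2 UK Unu => n ? [].
right; apply: (hK' U nu_) => //; last by move=> j i; exact: (cnu j (inr i)).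
by apply: filterS2 UK Unu => n ? [[]].
Qed.

Lemma closed_family_bigcap (F : (set measurable_measures)^nat) :
  (forall n, closed_family (F n)) -> closed_family (\bigcap_n F n).
Proof.
move=> hF; split; first by apply: bigcapT_measurable => n; case: (hF n).
have /choice[C hC] := fun n => (hF n).2.
apply: (@countably_closed_countType (nat * nat)%type (fun p => C p.1 p.2)).
  by move=> p; exact: (hC p.1).1.
move=> U nu_ nu UU Unu lnu cnu k _.
have PU : ProperFilter U by exact: ultra_proper.
apply: ((hC k).2 U nu_) => //; last by move=> j i; exact: (cnu j (k, i)).
by apply: filterS Unu => n [h ?]; split => //; exact: h.
Qed.

Let cell_mass j (B : set borelS) : measurable_measures -> R :=
  fun mu => fine ((mu : MS) (S_ j `&` B)).

Let cell_mass_measurable j B : measurable B -> measurable_fun setT (cell_mass j B).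
Proof.
move=> mB; apply: (measurableT_comp (f := @fine R)) => //.
by apply: eval_measurable; exact: measurableI.
Qed.

Let closed_family_ge j B c : measurable B ->
  closed_family [set mu | c <= cell_mass j B mu].
Proof.
move=> mB; split.
  rewrite (_ : [set mu | _] = cell_mass j B @^-1` `[c, +oo[).
    by rewrite -[X in measurable X]setTI; exact: cell_mass_measurable.
  by apply/seteqP; split => mu /=; rewrite in_itv/= andbT.
apply: (@countably_closed_countType unit (fun=> B)) => // U nu_ nu UU Unu lnu cnu.
have PU : ProperFilter U by exact: ultra_proper.
apply: (cvgr_to_ge (cnu j tt)).
by apply: filterS Unu => n [].
Qed.

Let closed_family_le j B c : measurable B ->
  closed_family [set mu | cell_mass j B mu <= c].
Proof.
move=> mB; split.
  rewrite (_ : [set mu | _] = cell_mass j B @^-1` `]-oo, c]).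
    by rewrite -[X in measurable X]setTI; exact: cell_mass_measurable.
  by apply/seteqP; split => mu /=; rewrite in_itv/=.
apply: (@countably_closed_countType unit (fun=> B)) => // U nu_ nu UU Unu lnu cnu.
have PU : ProperFilter U by exact: ultra_proper.
apply: (cvgr_to_le (cnu j tt)).
by apply: filterS Unu => n [].
Qed.

Lemma measure_partition (mu : MS) (B : set borelS) : measurable B ->
  mu B = (\sum_(0 <= j <oo) mu (S_ j `&` B))%E.
Proof.
move=> mB; rewrite -[in LHS](setIT B) -SU setI_bigcupr measure_semi_bigcup//.
- by apply: eq_eseriesr => j _; rewrite setIC.
- by move=> j; exact: measurableI.
- exact: trivIset_setIl.
- by rewrite -setI_bigcupr SU setIT.
Qed.

Lemma locfin_cell (mu : MS) j (B : set borelS) : locfin mu -> measurable B ->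
  mu (S_ j `&` B) \is a fin_num.
Proof.
move=> lmu mB; rewrite ge0_fin_numE//; apply: lmu; first exact: measurableI.
by have [x [r h]] := bS j; exists x, r => y [/h].
Qed.

(** It suffices to treat conditions on the mass in one bounded piece: a lower bound [c] is a closed
    condition, and its negation is the union over [n] of the closed conditions with upper bound
    [c - 1 / (n + 1)]. The mass of an arbitrary Borel set is the series of its masses in the
    pieces. *)
Lemma closed_family_inner_regular (q : set measurable_measures -> \bar R) :
  q set0 = 0%E -> (forall A, (0 <= q A)%E) ->
  (forall A B, measurable A -> measurable B -> A `<=` B -> (q A <= q B)%E) ->
  (forall F : (set measurable_measures)^nat, (forall n, measurable (F n)) ->
    (q (\bigcup_n F n) <= \sum_(n <oo) q (F n))%E) ->
  (forall F : (set measurable_measures)^nat, (forall n, measurable (F n)) ->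
    nonincreasing_seq F -> \bigcap_n F n = set0 -> q (F n) @[n --> \oo] --> 0%E) ->
  forall X, MS_measurable X -> inner_regular q closed_family X.
Proof.
move=> q0 q_ge0 q_le q_sub q_cvg0.
have KM : closed_family `<=` measurable by move=> K [].
have := inner_regular_sigma_algebra q0 q_ge0 q_le q_sub q_cvg0 KM
  closed_family0 closed_familyT closed_familyU closed_family_bigcap.
set V := [set _ | _] => sV.
have VK K : closed_family K -> inner_regular q closed_family K.
  exact: inner_regular_Kc.
(* Once [V] is the sigma-algebra of a type, regularity of an evaluation is measurability of a
   function, and the series is handled by the usual theorems. *)
pose MV := g_sigma_algebraType V.
have mVE (X : set MV) : measurable X = V X by rewrite (measurable_g_measurableTypeE sV).
have mlf : measurable (@locfin R S : set MV).
  by rewrite mVE; split; apply: VK; [exact: closed_family_locfin|exact: closed_family_locfinC].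
suff h : sigma_algebra (@locfin R S) V /\ @eval_gen R S `<=` V.
  move=> X mX; have : V X by exact: (smallest_sub h.1 h.2).
  by case.
split.
  split.
  - by case: sV.
  - by move=> A; rewrite -!mVE => mA; exact: measurableD.
  - by case: sV.
move=> _ [B [E [mB [mE ->]]]].
have mc j : measurable_fun setT (cell_mass j B : MV -> R).
  apply: (measurability _ (RGenCInfty.measurableE R)).
  move=> _ [_ [c ->] <-]; rewrite setTI mVE.
  rewrite (_ : _ @^-1` _ = [set mu | c <= cell_mass j B mu]); last first.
    by apply/seteqP; split => mu /=; rewrite in_itv/= andbT.
  split; first by apply: VK; exact: closed_family_ge.
  rewrite (_ : ~` _ = \bigcup_n [set mu | cell_mass j B mu <= c - n.+1%:R^-1]).
    apply: (inner_regular_bigcup q0 q_ge0 q_le q_sub q_cvg0 KM closed_family0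
      closed_familyU) => n.
    by apply: VK; exact: closed_family_le.
  apply/seteqP; split => mu /=.
    move=> /negP; rewrite -ltNge -subr_gt0 => h.
    have [n _ /(_ n (leqnn n)) hn] := near_infty_natSinv_lt (PosNum h).
    have hn' : n.+1%:R^-1 < c - cell_mass j B mu by exact: hn.
    by exists n => //=; move: hn'; move: (n.+1%:R^-1 : R) => t; lra.
  move=> [n _ /= h1] h2.
  have : (0 : R) < n.+1%:R^-1 by rewrite invr_gt0.
  by move: h1; move: (n.+1%:R^-1 : R) => t; lra.
(* The domain is [locfin] because the pieces are read through [fine], which would send an infinite
   mass to [0]. *)
rewrite -mVE; have : measurable_fun (@locfin R S : set MV) (fun mu : MV => (mu : MS) B).
  apply: (eq_measurable_fun (fun mu : MV => (\sum_(0 <= j <oo) (cell_mass j B mu)%:E)%E)).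
    move=> mu; rewrite inE => lmu; rewrite (measure_partition _ mB).
    by apply: eq_eseriesr => j _; rewrite fineK// locfin_cell.
  apply: ge0_emeasurable_sum => [j mu _ _|j _]; first by rewrite lee_fin fine_ge0.
  by apply/measurable_EFinP; apply: measurable_funS (mc j).
by apply.
Qed.

End closed_families.

(** * Monotone Lipschitz approximation of up-sets *)

Section monotone_approximation.
Context (R : realType) (S : completePseudoMetricType R).
Local Notation MS := (MS S).
Local Notation borelS := (borelS S).
Local Notation measurable_measures := (measurable_measures S).
Variable S_ : (set borelS)^nat.
Hypothesis mS : forall j, measurable (S_ j).
Hypothesis bS : forall j, mbounded (S_ j).
Hypothesis tS : trivIset setT S_.
Hypothesis SU : \bigcup_j S_ j = setT.

Definition masses (mu : MS) : set borelS -> R := fun B => fine (mu B).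

Section upper_envelope.
Variables (C : (set borelS)^nat) (K : set MS).

Definition cells n : seq (set borelS) :=
  [seq cell C S_ p | p <- enum {: 'I_n * {ffun 'I_n -> bool}}].

(** The same [n] governs the fineness of the cells and the slope, so that a positive value forces
    the deficit of [y] on ever finer cells below [1 / (n + 1)]. *)
Let bump n (nu : MS) (y : set borelS -> R) : R :=
  Num.max 0 (1 - n.+1%:R * \sum_(B <- cells n) Num.max 0 (masses nu B - y B)).

Let bump01 n nu y : 0 <= bump n nu y <= 1.
Proof.
rewrite /bump le_max lexx/= ge_max ler01/= gerBl mulr_ge0//.
by apply: sumr_ge0 => B _; rewrite le_max lexx.
Qed.

(* A continuous monotone majorant of the indicator of the up-set generated
   by [K]; the supremum is [0] when [K] is empty. *)
Definition envelope n (y : set borelS -> R) : R := sup [set bump n nu y | nu in K].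

Let bump_le_envelope n nu y : K nu -> bump n nu y <= envelope n y.
Proof.
move=> Knu; apply: ub_le_sup; last by exists nu.
by exists 1 => _ [nu' _ <-]; have /andP[] := bump01 n nu' y.
Qed.

Let envelope_le n y c : 0 <= c -> (forall nu, K nu -> bump n nu y <= c) ->
  envelope n y <= c.
Proof.
move=> c0 h; have [K0|/set0P[nu Knu]] := eqVneq K set0.
  by rewrite /envelope K0 image_set0 sup0.
apply: ge_sup; first by exists (bump n nu y), nu.
clear nu Knu.
by move=> _ [nu Knu <-]; exact: h.
Qed.

Lemma envelope_ge0 n y : 0 <= envelope n y.
Proof.
have [K0|/set0P[nu Knu]] := eqVneq K set0.
  by rewrite /envelope K0 image_set0 sup0.
by apply: le_trans (bump_le_envelope n y Knu); have /andP[] := bump01 n nu y.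
Qed.

Lemma envelope_le1 n y : envelope n y <= 1.
Proof. by apply: envelope_le => // nu _; have /andP[] := bump01 n nu y. Qed.

(** A supremum inherits a common one-sided Lipschitz bound, and each bump has it because [(a - z)^+]
    is at most [(a - y)^+ + (y - z)^+]. *)
Lemma envelope_oslip n : oslip (envelope n) n.+1%:R (cells n).
Proof.
split => // y z; rewrite lerBlDr.
set D := \sum_(B <- cells n) _.
have D0 : 0 <= D by apply: sumr_ge0 => B _; rewrite le_max lexx.
apply: envelope_le => [|nu Knu]; first by rewrite addr_ge0 ?mulr_ge0// envelope_ge0.
rewrite -lerBlDl (le_trans _ (bump_le_envelope n z Knu))//.
rewrite /bump; set a := \sum_(B <- cells n) _; set b := \sum_(B <- cells n) _.
have ba : b <= a + D.
  rewrite -big_split/=; apply: ler_sum => B _.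
  rewrite ge_max addr_ge0 ?le_max ?lexx//=.
  apply: (@le_trans _ _ ((masses nu B - y B) + (y B - z B))); first by lra.
  by apply: lerD; rewrite le_max lexx orbT.
have : n.+1%:R * b <= n.+1%:R * a + n.+1%:R * D :> R by rewrite -mulrDr ler_wpM2l.
have : 0 <= n.+1%:R * D by rewrite mulr_ge0.
move: (n.+1%:R * b) (n.+1%:R * a) (n.+1%:R * D) => b' a' D' D'0 h.
have [h0|h0] := leP (1 - a') 0.
  by rewrite le_max; apply/orP; left; lra.
by rewrite le_max; apply/orP; right; lra.
Qed.

Lemma envelope1 n nu : K nu -> 1 <= envelope n (masses nu).
Proof.
move=> Knu; apply: le_trans (bump_le_envelope n _ Knu); rewrite /bump big1 ?mulr0 ?subr0.
  by rewrite le_max lexx orbT.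
by move=> B _; rewrite subrr; apply/max_idPl.
Qed.

Lemma envelope_gt0 n (mu : MS) : 0 < envelope n (masses mu) ->
  exists2 nu, K nu & \sum_(B <- cells n) Num.max 0 (masses nu B - masses mu B) <= n.+1%:R^-1.
Proof.
move=> h; apply: contrapT => hn; move: h; apply/negP; rewrite -leNgt.
apply: envelope_le => // nu Knu; rewrite /bump ge_max lexx/= subr_le0.
rewrite -ler_pdivrMl// mulr1; apply: contrapT => /negP; rewrite -ltNge => h.
by apply: hn; exists nu => //; exact: ltW.
Qed.

End upper_envelope.

(* A measure at which the envelopes do not vanish dominates an ultralimit of
   elements of [K]. *)
Lemma envelope_eventually0 (C : (set borelS)^nat) (K : set MS) (mu : MS) :
  (forall i, measurable (C i)) -> K `<=` @locfin R S -> locfin mu ->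
  (forall (U : set_system nat) (nu_ : nat -> MS) (nu : MS), UltraFilter U ->
    (\forall n \near U, K (nu_ n) /\ locfin (nu_ n)) -> locfin nu ->
    (forall j i, fine (nu_ n (S_ j `&` C i)) @[n --> U] -->
                 fine (nu (S_ j `&` C i))) ->
    K nu) ->
  (forall nu, K nu -> ~ meas_le nu mu) ->
  \forall n \near \oo, envelope C K n (masses mu) = 0.
Proof.
move=> mC Kl lmu Kclosed Kmu; apply: contrapT => hnear.
(* As the envelopes are supposed not to vanish eventually, [A] is infinite. Eventuality along [A] is
   then a proper filter, and an ultrafilter above it contains [A] and all tails. *)
pose A := [set n : nat | 0 < envelope C K n (masses mu)].
have PW : ProperFilter (within A \oo).
  apply: Build_ProperFilter_ex.
  move=> B [n _ hB]; apply: contrapT => hn; apply: hnear; exists n => // k nk /=.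
  apply/eqP; rewrite eq_le envelope_ge0 andbT leNgt; apply/negP => Ak.
  by apply: hn; exists k; exact: hB.
have [U [UU WU]] := ultraFilterLemma PW.
have PU : ProperFilter U by exact: ultra_proper.
have ooU : \oo `<=` U by move=> B [n _ hB]; apply: WU; exists n => // k nk _; exact: hB.
have UA : U A by apply: WU; exists 0%N.
have /choice[nu_ hnu] : forall n, exists nu : MS, locfin nu /\ (A n -> K nu /\
    \sum_(B <- cells C n) Num.max 0 (masses nu B - masses mu B) <= n.+1%:R^-1).
  (* Off [A] any locally finite measure will do, as [U] does not see these indices. *)
  move=> n; have [An|nA] := pselect (A n); last by exists mu.
  have [nu Knu h] := envelope_gt0 An.
  by exists nu; split; [exact: Kl|].
have fS (nu : MS) j : locfin nu -> (nu (S_ j) < +oo)%E by move=> lnu; exact: lnu.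
have [|nu nu_le nu_cvg] := @dominated_limit_measure _ _ _ C mC S_ U mu nu_ mS tS SU UU ooU
  (fun j => fS mu j lmu) (fun n j => fS (nu_ n) j (hnu n).1).
  move=> e e0; near=> n.
  have An : A n by near: n.
  have := ((hnu n).2 An).2; rewrite /cells big_map big_enum/= => /le_trans; apply.
  near: n; apply: ooU; have := near_infty_natSinv_lt (PosNum e0).
  by apply: filterS => n /ltW.
have lnu : locfin nu by move=> B mB bB; apply: le_lt_trans (lmu B mB bB); exact: nu_le.
apply: (Kmu nu); last by move=> B mB _; exact: nu_le.
apply: (Kclosed U nu_) => //.
by near=> n; split; [apply: ((hnu n).2 _).1; near: n|exact: (hnu n).1].
Unshelve. all: by end_near. Qed.

Lemma cells_bounded (C : (set borelS)^nat) n B : (forall i, measurable (C i)) ->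
  B \in cells C n -> measurable B /\ mbounded B.
Proof.
move=> mC /mapP[p _ ->]; split.
  by apply: measurableI => //; exact: atom_measurable.
by have [x [r h]] := bS p.1; exists x, r => y [/h].
Qed.

Section fixed_random_measure.
Context d (Om : measurableType d) (P : probability Om R) (N : Om -> MS).
Hypothesis lN : forall w, locfin (N w).
Hypothesis mN : measurable_fun setT (N : Om -> measurable_measures).

Let preimage_measurable X : measurable (X : set measurable_measures) ->
  measurable (N @^-1` X).
Proof. by move=> mX; rewrite -[X in measurable X]setTI; exact: mN. Qed.

Lemma masses_measurable (F : (set borelS -> R) -> R) L Bs : oslip F L Bs ->
  (forall B, B \in Bs -> measurable B) ->
  measurable_fun setT (fun w => F (masses (N w))).
Proof.
move=> hF mBs; apply: (oslip_measurable (y := fun w => masses (N w)) hF) => B /mBs mB.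
apply: (measurableT_comp (f := @fine R)) => //.
exact: (measurableT_comp (eval_measurable mB) mN).
Qed.

(** The error splits along [V]. Inside, the envelope is at least [1] on [K], so for every [n] at
    most the probability of [V] minus [K] is lost. Outside, no member of [K] lies below the measure,
    as [V] is an up-set, so the envelopes vanish eventually and bounded convergence applies. *)
Lemma upset_approximation (V : set MS) (e : R) : MS_measurable V -> V `<=` @locfin R S ->
  (forall mu nu, locfin mu -> locfin nu -> meas_le mu nu -> V mu -> V nu) -> 0 < e ->
  exists (F : (set borelS -> R) -> R) L Bs, [/\ oslip F L Bs, forall y, 0 <= F y <= 1,
    forall B, B \in Bs -> measurable B /\ mbounded B &
    \int[P]_w `|F (masses (N w)) - \1_V (N w)| <= e].
Proof.
move=> mV Vl Vup e0; have e20 : 0 < e / 2 by rewrite divr_gt0.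
have lV : measurable (V : set measurable_measures).
  by rewrite measurable_measuresE (_ : _ `&` V = V)// setIC; exact: setIidl.
pose q (X : set measurable_measures) := P (N @^-1` X).
have q0 : q set0 = 0%E by rewrite /q preimage_set0 measure0.
have q_le A B : measurable A -> measurable B -> A `<=` B -> (q A <= q B)%E.
  move=> mA mB AB; apply: le_measure; rewrite ?inE; [exact: preimage_measurable..|].
  exact: preimage_subset.
have q_sub (F : (set measurable_measures)^nat) : (forall n, measurable (F n)) ->
    (q (\bigcup_n F n) <= \sum_(n <oo) q (F n))%E.
  move=> mF; rewrite /q preimage_bigcup; apply: measure_sigma_subadditive => //.
    by move=> n; exact: preimage_measurable.
  by apply: bigcupT_measurable => n; exact: preimage_measurable.
have q_cvg0 (F : (set measurable_measures)^nat) : (forall n, measurable (F n)) ->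
    nonincreasing_seq F -> \bigcap_n F n = set0 -> q (F n) @[n --> \oo] --> 0%E.
  move=> mF dF F0; rewrite /q -(measure0 P).
  rewrite -(preimage_set0 N) -F0 preimage_bigcap.
  apply: (nonincreasing_cvg_mu (F := fun n => N @^-1` F n)).
  - by rewrite (le_lt_trans (probability_le1 _ _)) ?ltry//; exact: preimage_measurable.
  - by move=> i; exact: preimage_measurable.
  - by apply: bigcapT_measurable => i; exact: preimage_measurable.
  - by move=> m n mn; apply/subsetPset; apply: preimage_subset; apply/subsetPset; exact: dF.
have [_ /(_ _ e20)[K [[mK [C [mC Kclosed]]] KV qK]]] :=
  closed_family_inner_regular mS bS tS SU q0 (fun A => measure_ge0 _ _) q_le q_sub q_cvg0 mV.
pose F := envelope C K.
have oF n : oslip (F n) n.+1%:R (cells C n) by exact: envelope_oslip.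
have mF n : measurable_fun setT (fun w => F n (masses (N w))).
  by apply: masses_measurable (oF n) _ => B /(cells_bounded mC)[].
have F01 n y : 0 <= F n y <= 1 by rewrite envelope_ge0 envelope_le1.
have mi X : measurable (X : set measurable_measures) ->
    measurable_fun setT (fun w => \1_X (N w) : R).
  move=> mX; have h : measurable_fun setT (\1_X : measurable_measures -> R).
    exact: measurable_indic.
  exact: (measurableT_comp h mN).
pose u n w : R := F n (masses (N w)) * \1_(~` V) (N w).
have mu n : measurable_fun setT (u n).
  by apply: measurable_funM => //; apply: mi; exact: measurableC.
have i1 (X : set MS) x : X x -> \1_X x = 1 :> R by move=> Xx; rewrite indicE mem_set.
have i0 (X : set MS) x : ~ X x -> \1_X x = 0 :> R by move=> Xx; rewrite indicE memNset.
have i01 (X : set MS) x : 0 <= (\1_X x : R) <= 1.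
  by rewrite indicE; case: (_ \in _); rewrite ?lexx ?ler01.
have u1 n w : `|u n w| <= 1.
  have /andP[a0 a1] := F01 n (masses (N w)); have /andP[b0 b1] := i01 (~` V) (N w).
  by rewrite ger0_norm ?mulr_ge0// mulr_ile1.
have u0 w : u n w @[n --> \oo] --> (0 : R).
  have [Vw|nVw] := pselect (V (N w)).
    rewrite (_ : (fun n => u n w) = cst 0); first exact: cvg_cst.
    by apply/funext => n; rewrite /u i0 ?mulr0// => /(_ Vw).
  apply: cvg_near_cst.
  have Kl : K `<=` @locfin R S by move=> x /KV /Vl.
  have := @envelope_eventually0 C K (N w) mC Kl (lN w) Kclosed.
  have Kmu nu : K nu -> ~ meas_le nu (N w).
    by move=> Knu h; apply: nVw; apply: Vup h (KV _ Knu) => //; exact: Kl.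
  by move=> /(_ Kmu); apply: filterS => n h; rewrite /u /F h mul0r.
have : \int[P]_w `|u n w - cst 0 w| @[n --> \oo] --> 0.
  exact: (@bounded_convergence _ _ _ P u (cst 0) 1).
move=> /cvgrPdist_le/(_ _ e20)[n _ /(_ n (leqnn n)) hn].
exists (F n), n.+1%:R, (cells C n); split => //; first by move=> B; exact: cells_bounded.
have mVK : measurable (V `\` K : set measurable_measures) by exact: measurableD.
apply: (@le_trans _ _ (\int[P]_w (\1_(V `\` K) (N w) + `|u n w - 0|))).
   apply: (@bounded_expectation_le _ _ _ P (fun w => `|F n (masses (N w)) - \1_V (N w)|)
    (fun w => \1_(V `\` K) (N w) + `|u n w - 0|) (1 + 1) (1 + (1 + 0))).
  - by apply: dist_measurable => //; exact: mi.
  - apply: measurable_funD; first exact: mi.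
    by apply: (@dist_measurable _ _ _ (u n) (cst 0)).
  - move=> w; have /andP[a0 a1] := F01 n (masses (N w)); have /andP[b0 b1] := i01 V (N w).
    by apply: dist_bounded; rewrite ger0_norm.
  - move=> w; have /andP[b0 b1] := i01 (V `\` K) (N w).
    rewrite (le_trans (ler_normD _ _))// lerD//; first by rewrite ger0_norm.
    by rewrite normr_id subr0 addr0.
  - move=> w; rewrite subr0 /u.
    have /andP[a0 a1] := F01 n (masses (N w)).
    have [Vw|nVw] := pselect (V (N w)).
      rewrite (i1 V)// (i0 (~` V)) ?mulr0 ?normr0 ?addr0; last by move=> /(_ Vw).
      rewrite ler0_norm ?subr_le0// opprB.
      have [Kw|nKw] := pselect (K (N w)).
        have a1' := envelope1 C n Kw; have /andP[b0 _] := i01 (V `\` K) (N w).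
        by apply: le_trans b0; rewrite subr_le0.
      by rewrite i1// gerBl.
    by rewrite (i0 V)// (i1 (~` V))// i0 ?subr0 ?mulr1 ?add0r//; case.
rewrite RintegralD//; last 2 first.
- apply: (@bounded_integrable _ _ _ P _ 1); first exact: mi.
  by move=> w; have /andP[b0 b1] := i01 (V `\` K) (N w); rewrite ger0_norm.
- apply: (@bounded_integrable _ _ _ P _ (1 + 1)); first exact: (@dist_measurable _ _ _ (u n) (cst 0)).
  by move=> w; apply: dist_bounded => //; rewrite normr0.
rewrite [leRHS]splitr lerD//; last first.
  by move: hn; rewrite sub0r normrN => /(le_trans (ler_norm _)).
rewrite -lee_fin; apply: le_trans qK; rewrite /q.
rewrite -[X in P X]setIT -integral_indic//; last exact: preimage_measurable.
rewrite (@bounded_expectationE _ _ _ P (\1_(N @^-1` (V `\` K))) 1)//.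
- exact: measurable_indic (preimage_measurable mVK).
- by move=> w; rewrite indicE; case: (_ \in _); rewrite ?normr0 ?normr1.
Qed.

End fixed_random_measure.
End monotone_approximation.

(** * From up-sets to bounded nondecreasing functionals *)

Section layer_cake.
Context (R : realType) (S : completePseudoMetricType R).
Local Notation MS := (MS S).
Local Notation borelS := (borelS S).
Local Notation measurable_measures := (measurable_measures S).
Variable S_ : (set borelS)^nat.
Hypothesis mS : forall j, measurable (S_ j).
Hypothesis bS : forall j, mbounded (S_ j).
Hypothesis tS : trivIset setT S_.
Hypothesis SU : \bigcup_j S_ j = setT.

(** The sum counts the integers from [1] to [m + 1] that are at most [(m + 1) * t], so it is the
    integer part [k] of that product. *)
Lemma staircase_dist (t : R) m : 0 <= t <= 1 ->
  `|m.+1%:R^-1 * \sum_(i < m.+1) (i.+1%:R / m.+1%:R <= t)%R%:R - t| <= m.+1%:R^-1 :> R.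
Proof.
move=> /andP[t0 t1]; have m0 : (0 : R) < m.+1%:R by [].
pose k := Num.truncn (m.+1%:R * t).
have mt0 : 0 <= m.+1%:R * t by rewrite mulr_ge0.
have /andP[k1 k2] := truncn_itv mt0; rewrite -/k in k1 k2.
have km : (k <= m.+1)%N by rewrite -(ler_nat R) (le_trans k1)// ler_piMr.
have -> : \sum_(i < m.+1) (i.+1%:R / m.+1%:R <= t)%R%:R = k%:R :> R.
  rewrite (eq_bigr (fun i : 'I_m.+1 => (i < k)%N%:R)); last first.
    move=> i _; congr (nat_of_bool _)%:R.
    by rewrite ler_pdivrMr// [t * _]mulrC truncn_gt_nat.
  rewrite -natr_sum -(big_mkord xpredT (fun i => nat_of_bool (i < k)%N)).
  rewrite (big_cat_nat (leq0n k) km)/= [X in (_ + X)%N]big_nat_cond [X in (_ + X)%N]big1 ?addn0; last first.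
    by move=> i /andP[/andP[ki _] _]; rewrite ltnNge ki.
  rewrite big_nat_cond (eq_bigr (fun=> 1%N)); last by move=> i /andP[/andP[_ ->]].
  by rewrite -big_nat_cond sum_nat_const_nat subn0 muln1.
rewrite -[X in _ - X](mulKf (lt0r_neq0 m0)) -mulrBr normrM ger0_norm ?invr_ge0//.
rewrite ler_piMr ?invr_ge0// distrC ger0_norm ?subr_ge0// lerBlDl.
by rewrite natr1 ltW.
Qed.

(** Measurability of [f] is known on [locfin] only, which is enough because [N] takes its values
    there. *)
Lemma MS_measurable_fun_comp d (Om : measurableType d) (N : Om -> MS) (f : MS -> R) :
  (forall w, locfin (N w)) -> measurable_fun setT (N : Om -> measurable_measures) ->
  MS_measurable_fun f -> measurable_fun setT (f \o N).
Proof.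
move=> lN mN mf _ E mE; rewrite setTI.
have mX : measurable (@locfin R S `&` f @^-1` E : set measurable_measures).
  by rewrite measurable_measuresE setIA setIid; exact: mf.
rewrite (_ : _ @^-1` _ = N @^-1` (@locfin R S `&` f @^-1` E)).
  by rewrite -[X in measurable X]setTI; exact: mN.
by apply/seteqP; split => w //= [].
Qed.

Context d (Om : measurableType d) (P : probability Om R) (N : Om -> MS).
Hypothesis lN : forall w, locfin (N w).
Hypothesis mN : measurable_fun setT (N : Om -> measurable_measures).

Let approx_sum (V : nat -> set MS) (e : R) n :
  (forall i, MS_measurable (V i)) -> (forall i, V i `<=` @locfin R S) ->
  (forall i mu nu, locfin mu -> locfin nu -> meas_le mu nu -> V i mu -> V i nu) ->
  0 < e -> exists (F : (set borelS -> R) -> R) L Bs, [/\ oslip F L Bs,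
    forall y, 0 <= F y <= n%:R, forall B, B \in Bs -> measurable B /\ mbounded B &
    \int[P]_w `|F (masses (N w)) - \sum_(i < n) \1_(V i) (N w)| <= n%:R * e].
Proof.
move=> mV Vl Vup e0.
have mi i : measurable_fun setT (fun w => \1_(V i) (N w) : R).
  have lV : measurable (V i : set measurable_measures).
    by rewrite measurable_measuresE (_ : _ `&` V i = V i)// setIC; exact: setIidl.
  have h : measurable_fun setT (\1_(V i) : measurable_measures -> R).
    exact: measurable_indic.
  exact: (measurableT_comp h mN).
have i01 i w : 0 <= (\1_(V i) (N w) : R) <= 1.
  by rewrite indicE; case: (_ \in _); rewrite ?lexx ?ler01.
elim: n => [|n [F [L [Bs [oF F01 hBs hF]]]]].
  exists (fun=> 0), 0, [::]; split => //; first exact: oslip_cst.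
    by move=> y; rewrite lexx.
  under eq_Rintegral do rewrite big_ord0 subrr normr0.
  by rewrite (Rintegral_prob_cst P) mul0r.
have [F' [L' [Bs' [oF' F'01 hBs' hF']]]] :=
  upset_approximation mS bS tS SU P lN mN (mV n) (Vl n) (@Vup n) e0.
have oFF := oslip_add oF oF'.
have hBB B : B \in Bs ++ Bs' -> measurable B /\ mbounded B.
  by rewrite mem_cat => /orP[/hBs|/hBs'].
exists (fun y => F y + F' y), (L + L'), (Bs ++ Bs'); split => //.
  by move=> y; have /andP[? ?] := F01 y; have /andP[? ?] := F'01 y; rewrite addr_ge0//= -natr1 lerD.
have mF : measurable_fun setT (fun w => F (masses (N w))).
  by apply: (masses_measurable mN oF) => B /hBs[].
have mF' : measurable_fun setT (fun w => F' (masses (N w))).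
  by apply: (masses_measurable mN oF') => B /hBs'[].
have ms : measurable_fun setT (fun w => \sum_(i < n) \1_(V i) (N w) : R).
  by apply: measurable_sum => i; exact: mi.
have s0n w : 0 <= \sum_(i < n) (\1_(V i) (N w) : R) <= n%:R.
  apply/andP; split; first by apply: sumr_ge0 => i _; have /andP[] := i01 i w.
  apply: (@le_trans _ _ (\sum_(i < n) 1)); last by rewrite sumr_const card_ord.
  by apply: ler_sum => i _; have /andP[] := i01 i w.
have b1 w : `|F (masses (N w)) - \sum_(i < n) \1_(V i) (N w)| <= n%:R + n%:R.
  have /andP[? ?] := F01 (masses (N w)); have /andP[? ?] := s0n w.
  by rewrite (le_trans (ler_normB _ _))// lerD// ger0_norm.
have b2 w : `|F' (masses (N w)) - \1_(V n) (N w)| <= 1 + 1.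
  have /andP[? ?] := F'01 (masses (N w)); have /andP[? ?] := i01 n w.
  by rewrite (le_trans (ler_normB _ _))// lerD// ger0_norm.
have le_sum w : `|F (masses (N w)) + F' (masses (N w)) - \sum_(i < n.+1) \1_(V i) (N w)|
    <= `|F (masses (N w)) - \sum_(i < n) \1_(V i) (N w)| +
       `|F' (masses (N w)) - \1_(V n) (N w)|.
  by rewrite big_ord_recr/= opprD addrACA ler_normD.
have m1 := dist_measurable mF ms; have m2 := dist_measurable mF' (mi n).
rewrite -natr1 mulrDl mul1r; apply: le_trans (lerD hF hF').
rewrite -RintegralD//; last 2 first.
- by apply: (@bounded_integrable _ _ _ P _ (n%:R + n%:R)) => // w; rewrite normr_id.
- by apply: (@bounded_integrable _ _ _ P _ (1 + 1)) => // w; rewrite normr_id.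
apply: (bounded_expectation_le P (C := n%:R + n%:R + (1 + 1)) (C' := n%:R + n%:R + (1 + 1))) => //.
- apply: (dist_measurable (u := fun w => F (masses (N w)) + F' (masses (N w)))).
    exact: measurable_funD.
  by apply: measurable_sum => i; exact: mi.
- exact: measurable_funD.
- by move=> w; rewrite normr_id (le_trans (le_sum w))// lerD.
- by move=> w; rewrite ger0_norm ?addr_ge0// lerD.
Qed.

Lemma monotone_approximation (f : MS -> R) (C e : R) : 0 < C ->
  (forall mu, locfin mu -> `|f mu| <= C) -> MS_measurable_fun f ->
  MS_nondecreasing f -> 0 < e ->
  exists (F : (set borelS -> R) -> R) L Bs, [/\ oslip F L Bs,
    forall y, `|F y| <= C, forall B, B \in Bs -> measurable B /\ mbounded B &
    \int[P]_w `|F (masses (N w)) - f (N w)| <= e].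
Proof.
move=> C0 fC mf fup e0.
have C20 : 0 < 2 * C by rewrite mulr_gt0.
(* This tolerance is spent twice, on the mesh of the staircase and on each indicator; undoing the
   rescaling of [f] to [[0, 1]] multiplies both by [2 * C]. *)
pose e' := e / (2 * (2 * C)); have e'0 : 0 < e' by rewrite divr_gt0// mulr_gt0.
have [m hm] : exists m : nat, m.+1%:R^-1 <= e'.
  have [m _ /(_ m (leqnn m)) hm] := near_infty_natSinv_lt (PosNum e'0).
  by exists m; exact: ltW.
pose g mu := (f mu + C) / (2 * C).
have g01 mu : locfin mu -> 0 <= g mu <= 1.
  move=> /fC; rewrite ler_norml => /andP[h1 h2].
  rewrite /g divr_ge0 ?(ltW C20)//=; last by lra.
  by rewrite ler_pdivrMr// mul1r; lra.
pose V i : set MS := [set mu | locfin mu /\ i.+1%:R / m.+1%:R <= g mu].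
have mV i : MS_measurable (V i).
  have -> : V i = @locfin R S `&` f @^-1` `[i.+1%:R / m.+1%:R * (2 * C) - C, +oo[.
    by apply/seteqP; split => mu /=; rewrite /V /g /= in_itv/= andbT ler_pdivlMr// lerBlDr.
  exact: mf.
have Vup i mu nu : locfin mu -> locfin nu -> meas_le mu nu -> V i mu -> V i nu.
  move=> lmu lnu munu [_ h]; split => //; apply: le_trans h _.
  by rewrite /g ler_pM2r ?invr_gt0// lerD2r fup.
have [F [L [Bs [oF F01 hBs hF]]]] := approx_sum m.+1 mV (fun i mu => @proj1 _ _) Vup e'0.
pose F' y := 2 * C * (m.+1%:R^-1 * F y) + - C.
have oF' : oslip F' (2 * C * (m.+1%:R^-1 * L) + 0) (Bs ++ [::]).
  apply: oslip_add; last exact: oslip_cst.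
  by apply: oslip_scale; [exact: ltW|apply: oslip_scale].
have F'C y : `|F' y| <= C.
  have /andP[h1 h2] := F01 y; rewrite /F'.
  have h3 : 0 <= m.+1%:R^-1 * F y <= 1.
    by rewrite mulr_ge0//= ler_pdivrMl// mulr1.
  have : 2 * C * 0 <= 2 * C * (m.+1%:R^-1 * F y) <= 2 * C * 1.
    by rewrite !ler_pM2l.
  by move: (_ * (_ * F y)) => t /andP[? ?]; rewrite ler_norml; lra.
exists F', (2 * C * (m.+1%:R^-1 * L) + 0), (Bs ++ [::]); split => //.
  by move=> B; rewrite cats0 => /hBs.
have mF : measurable_fun setT (fun w => F (masses (N w))).
  by apply: (masses_measurable mN oF) => B /hBs[].
have mF' : measurable_fun setT (fun w => F' (masses (N w))).
  by apply: (masses_measurable mN oF') => B; rewrite cats0 => /hBs[].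
have mfN := MS_measurable_fun_comp lN mN mf.
pose s w : R := \sum_(i < m.+1) \1_(V i) (N w).
have ms : measurable_fun setT s.
  apply: measurable_sum => i.
  have lV : measurable (V i : set measurable_measures).
    by rewrite measurable_measuresE (_ : _ `&` V i = V i)// setIC; apply: setIidl => mu [].
  have h : measurable_fun setT (\1_(V i) : measurable_measures -> R).
    exact: measurable_indic.
  exact: (measurableT_comp h mN).
have s0m w : `|s w| <= m.+1%:R.
  apply: (le_trans (ler_norm_sum _ _ _)).
  apply: (@le_trans _ _ (\sum_(i < m.+1) 1)); last by rewrite sumr_const card_ord.
  by apply: ler_sum => i _; rewrite indicE; case: (_ \in _); rewrite ?normr0 ?normr1.
have FC w : `|F (masses (N w))| <= m.+1%:R.
  by have /andP[? ?] := F01 (masses (N w)); rewrite ger0_norm.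
have key w : `|F' (masses (N w)) - f (N w)| <=
    2 * C * (m.+1%:R^-1 * `|F (masses (N w)) - s w|) + 2 * C * m.+1%:R^-1.
  have -> : F' (masses (N w)) - f (N w) =
     2 * C * (m.+1%:R^-1 * (F (masses (N w)) - s w) + (m.+1%:R^-1 * s w - g (N w))).
    rewrite /F' /g; field.
    by rewrite (lt0r_neq0 C0)/= addrC natr1 pnatr_eq0.
  rewrite normrM gtr0_norm// -mulrDr ler_pM2l// (le_trans (ler_normD _ _))//.
  apply: lerD; first by rewrite normrM ger0_norm ?invr_ge0.
  rewrite /s (eq_bigr (fun i : 'I_m.+1 => (i.+1%:R / m.+1%:R <= g (N w))%R%:R)).
    by apply: staircase_dist; exact: g01.
  move=> i _; rewrite indicE; congr (nat_of_bool _)%:R.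
  by apply/idP/idP => [|h]; rewrite inE; [case|split; [exact: lN|]].
have mFs := dist_measurable mF ms.
have iFs : P.-integrable setT (EFin \o (fun w => `|F (masses (N w)) - s w|)).
  by apply: (@bounded_integrable _ _ _ P _ (m.+1%:R + m.+1%:R)) => // w; exact: dist_bounded.
have iFs' : P.-integrable setT (EFin \o (fun w => m.+1%:R^-1 * `|F (masses (N w)) - s w|)).
  exact: integrableZl iFs.
have iFs'' : P.-integrable setT (EFin \o (fun w => 2 * C * (m.+1%:R^-1 * `|F (masses (N w)) - s w|))).
  exact: integrableZl iFs'.
have ic : P.-integrable setT (EFin \o (fun=> 2 * C * m.+1%:R^-1)).
  exact: (@bounded_integrable _ _ _ P _ `|2 * C * m.+1%:R^-1|).
apply: (@le_trans _ _ (\int[P]_w (2 * C * (m.+1%:R^-1 * `|F (masses (N w)) - s w|) + 2 * C * m.+1%:R^-1))).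
  apply: le_Rintegral => //.
    apply: (@bounded_integrable _ _ _ P _ (C + C)); first exact: dist_measurable.
    by move=> w; apply: dist_bounded => //; exact: fC.
  exact: (integrableD measurableT iFs'' ic).
rewrite RintegralD// (Rintegral_prob_cst P) RintegralZl// RintegralZl//.
have h1 : m.+1%:R^-1 * (\int[P]_w `|F (masses (N w)) - s w|) <= e'.
  by rewrite ler_pdivrMl.
have -> : e = 2 * C * e' + 2 * C * e' by rewrite /e'; field; lra.
by rewrite lerD// ler_pM2l.
Qed.

End layer_cake.

(** * Distance to a set, capped at one *)

Section capped_distance.
Context (R : realType) (S : completePseudoMetricType R).
Implicit Types (A B : set S) (x y : S).

(* [min 1 (d(x, A))]; the cap makes the value [1] when [A] is empty or when
   [A] lies at infinite distance from [x]. *)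
Definition capdist A x : R :=
  inf [set r | r = 1 \/ 0 < r /\ exists2 a, A a & ball x r a].

Let has_inf_capdist A x :
  has_inf [set r : R | r = 1 \/ 0 < r /\ exists2 a, A a & ball x r a].
Proof.
split; first by exists 1; left.
by exists 0 => r [->//|[/ltW]].
Qed.

Lemma capdist_ge0 A x : 0 <= capdist A x.
Proof.
apply: lb_le_inf => [|r]; last by move=> [->//|[/ltW]].
by case: (has_inf_capdist A x).
Qed.

Lemma capdist_le A x a r : 0 < r -> A a -> ball x r a -> capdist A x <= r.
Proof.
move=> r0 Aa xa; apply: ge_inf; first by case: (has_inf_capdist A x).
by right; split => //; exists a.
Qed.

Lemma capdist_le1 A x : capdist A x <= 1.
Proof. by apply: ge_inf; [case: (has_inf_capdist A x)|left]. Qed.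

(** The condition [r <= 1] excludes the cap, so the infimum is approached by a radius that comes
    from a point of [A]. *)
Lemma capdist_lt A x r : capdist A x < r -> r <= 1 -> exists2 a, A a & ball x r a.
Proof.
move=> h r1; have e0 : 0 < r - capdist A x by rewrite subr_gt0.
have [s [->|[s0 [a Aa xa]]]] := inf_adherent e0 (has_inf_capdist A x).
  by rewrite -/(capdist A x) addrC subrK ltNge r1.
rewrite -/(capdist A x) addrC subrK => sr.
by exists a => //; apply: le_ball xa; exact: ltW.
Qed.

Lemma capdist0 A x : A x -> capdist A x = 0.
Proof.
move=> Ax; apply/eqP; rewrite eq_le capdist_ge0 andbT.
apply/ler_addgt0Pl => e e0; rewrite addr0; apply: (capdist_le e0 Ax).
exact: ballxx.
Qed.

Lemma capdist_lipschitz A x y r : 0 < r -> ball x r y ->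
  capdist A x <= r + capdist A y.
Proof.
move=> r0 xy; rewrite -lerBlDl; apply: lb_le_inf.
  by case: (has_inf_capdist A y).
move=> s [->|[s0 [a Aa ya]]]; rewrite lerBlDl.
  by rewrite (le_trans (capdist_le1 _ _))// lerDr ltW.
by apply: (capdist_le _ Aa); [rewrite addr_gt0|exact: ball_triangle xy ya].
Qed.

Lemma capdist_continuous A : continuous (capdist A).
Proof.
move=> x; apply/cvgrPdist_le => e e0; near=> y.
have xy : ball x e y by near: y; exact: nbhsx_ballx.
rewrite ler_norml; apply/andP; split.
  by rewrite lerNl opprB lerBlDr; apply: capdist_lipschitz => //; exact: ball_sym.
by rewrite lerBlDr; exact: capdist_lipschitz.
Unshelve. all: by end_near. Qed.

Lemma capdist_gt0 A x : closed A -> ~ A x -> 0 < capdist A x.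
Proof.
move=> cA nAx; rewrite lt_neqAle capdist_ge0 andbT; apply/eqP => d0.
apply: nAx; apply: cA => B /nbhs_ballP[e /= e0 xeB].
have h : capdist A x < Num.min e 1 by rewrite -d0 lt_min e0/=.
have [|a Aa xa] := capdist_lt h; first by rewrite ge_min lexx orbT.
exists a; split => //; apply: xeB; apply: le_ball xa.
by rewrite ge_min lexx.
Qed.

Lemma capdist_subset A B x : A `<=` B -> capdist B x <= capdist A x.
Proof.
move=> AB; apply: lb_le_inf; first by case: (has_inf_capdist A x).
move=> r [->|[r0 [a Aa xa]]]; first exact: capdist_le1.
by apply: (capdist_le r0 _ xa); exact: AB.
Qed.

End capped_distance.

(** * Approximation of Borel sets by closed subsets *)

Section closed_approximation.
Context (R : realType) (S : completePseudoMetricType R).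
Local Notation MS := (MS S).
Local Notation borelS := (borelS S).
Local Notation measurable_measures := (measurable_measures S).

(** Open sets generate, so only they need checking: the complement is closed, and an open set is the
    union over [n] of the closed sets where the capped distance to its complement is at least
    [1 / (n + 1)]. *)
Lemma closed_inner_regular (q : set borelS -> \bar R) :
  q set0 = 0%E -> (forall A, (0 <= q A)%E) ->
  (forall A B, measurable A -> measurable B -> A `<=` B -> (q A <= q B)%E) ->
  (forall F : (set borelS)^nat, (forall n, measurable (F n)) ->
    (q (\bigcup_n F n) <= \sum_(n <oo) q (F n))%E) ->
  (forall F : (set borelS)^nat, (forall n, measurable (F n)) ->
    nonincreasing_seq F -> \bigcap_n F n = set0 -> q (F n) @[n --> \oo] --> 0%E) ->
  forall X, measurable X -> inner_regular q (@closed S) X.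
Proof.
move=> q0 q_ge0 q_le q_sub q_cvg0 X mX.
have KM : @closed S `<=` (@measurable _ borelS) by move=> K; exact: closed_borel.
have Kbig (F : (set borelS)^nat) : (forall n, @closed S (F n)) ->
    @closed S (\bigcap_n F n) by move=> hF; apply: closed_bigI => n _; exact: hF.
have := inner_regular_sigma_algebra q0 q_ge0 q_le q_sub q_cvg0 KM
  (@closed0 S) (@closedT S) (@closedU S) Kbig.
set V := [set _ | _] => sV.
suff /(_ _ mX)[] : (@measurable _ borelS) `<=` V by [].
apply: smallest_sub => //= O oO; split; last first.
  by apply: inner_regular_Kc => //; exact: open_closedC.
rewrite (_ : O = \bigcup_n [set x | n.+1%:R^-1 <= capdist (~` O) x]).
  apply: (inner_regular_bigcup q0 q_ge0 q_le q_sub q_cvg0 KM (@closed0 S) (@closedU S)) => n.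
  apply: inner_regular_Kc => //.
  have := @closed_comp _ _ (capdist (~` O)) [set r : R | n.+1%:R^-1 <= r].
  by apply; [move=> x _; exact: capdist_continuous|exact: closed_ge].
apply/seteqP; split => x /=.
  move=> Ox; have h : 0 < capdist (~` O) x.
    by apply: capdist_gt0; [exact: open_closedC|move=> /(_ Ox)].
  have [n _ /(_ n (leqnn n)) hn] := near_infty_natSinv_lt (PosNum h).
  by exists n => //=; exact: ltW.
move=> [n _ /= h]; apply: contrapT => nO.
by move: h; rewrite capdist0// leNgt invr_gt0 ltr0n.
Qed.

Lemma restr_random_measure d (Om : measurableType d) (M : Om -> MS)
    (A : set borelS) (mA : measurable A) :
  random_measure M -> random_measure (restr mA \o M).
Proof.
move=> rM; have mM := random_measure_measurable rM.
have lN w : locfin (restr mA (M w)).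
  move=> B mB bB; apply: le_lt_trans (rM.1 w B mB bB).
  by rewrite /= /mrestr; apply: le_measure; rewrite ?inE//; exact: measurableI.
split => // X mX.
suff h : sigma_algebra (@locfin R S) [set Y | measurable ((restr mA \o M) @^-1` Y)] /\
    @eval_gen R S `<=` [set Y | measurable ((restr mA \o M) @^-1` Y)].
  exact: (smallest_sub h.1 h.2 mX).
split.
  split => /=.
  - by rewrite preimage_set0.
  - move=> Y mY; rewrite (_ : _ @^-1` _ = ~` ((restr mA \o M) @^-1` Y)).
      exact: measurableC.
    by apply/seteqP; split => w /=; [case|split => //; exact: lN].
  - by move=> F mF; rewrite preimage_bigcup; exact: bigcupT_measurable.
move=> _ [B [E [mB [mE ->]]]] /=.
rewrite (_ : _ @^-1` _ = (fun w => M w (B `&` A)) @^-1` E); last first.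
  by apply/seteqP; split => w /=; [case|split => //; exact: lN].
rewrite -[X in measurable X]setTI.
have h : measurable_fun setT (fun w => M w (B `&` A)).
  apply: (measurableT_comp _ mM (f := fun mu : measurable_measures => (mu : MS) (B `&` A))).
  by apply: eval_measurable; exact: measurableI.
exact: h.
Qed.

Context d (Om : measurableType d) (P : probability Om R) (M : Om -> MS).
Hypothesis rM : random_measure M.

Let mass_measurable (B : set borelS) : measurable B -> measurable_fun setT (fun w => fine (M w B)).
Proof.
move=> mB; apply: (measurableT_comp (f := @fine R)) => //.
exact: (measurableT_comp (eval_measurable mB) (random_measure_measurable rM)).
Qed.

Let capped_mass (B X : set borelS) w : R := Num.min 1 (fine (M w (B `&` X))).

Let capped_mass_measurable (B X : set borelS) : measurable B -> measurable X ->
  measurable_fun setT (capped_mass B X).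
Proof.
move=> mB mX; apply: (measurable_minr (f := cst 1)) => //.
by apply: mass_measurable; exact: measurableI.
Qed.

Let capped_mass01 B X w : 0 <= capped_mass B X w <= 1.
Proof. by rewrite /capped_mass le_min ler01 fine_ge0//= ge_min lexx. Qed.

Let mass_fin (B X : set borelS) w : measurable B -> mbounded B -> measurable X ->
  M w (B `&` X) \is a fin_num.
Proof.
move=> mB [x [r Br]] mX; rewrite ge0_fin_numE//; apply: rM.1.
  exact: measurableI.
by exists x, r => y [/Br].
Qed.

(* The capped mass makes expectations finite without assuming that the
   intensity measure of [M] is locally finite. *)
Lemma random_measure_closed_approximation (B X : set borelS) (dl : R) : measurable B -> mbounded B ->
  measurable X -> 0 < dl ->
  exists K : set S, [/\ closed K, K `<=` X &
    \int[P]_w Num.min 1 (fine (M w (B `&` (X `\` K)))) <= dl].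
Proof.
move=> mB bB mX dl0.
pose q Y : \bar R := (\int[P]_w (capped_mass B Y w)%:E)%E.
have cm0 Y w : (0 <= (capped_mass B Y w)%:E)%E.
  by have /andP[? _] := capped_mass01 B Y w; rewrite lee_fin.
have q_ge0 Y : (0 <= q Y)%E by apply: integral_ge0 => w _.
have mcm Y : measurable Y -> measurable_fun setT (EFin \o capped_mass B Y).
  by move=> mY; apply/measurable_EFinP; exact: capped_mass_measurable.
have q0 : q set0 = 0%E.
  rewrite /q (eq_integral (cst 0%E)) ?integral0// => w _ /=.
  by rewrite /capped_mass setI0 measure0 min_r.
have q_le Y Z : measurable Y -> measurable Z -> Y `<=` Z -> (q Y <= q Z)%E.
  move=> mY mZ YZ; apply: ge0_le_integral => //; [exact: mcm..|].
  move=> w _; rewrite lee_fin /capped_mass le_min !ge_min lexx/=.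
  apply/orP; right; apply: fine_le; [exact: mass_fin..|].
  by apply: le_measure; rewrite ?inE; [exact: measurableI..|exact: setIS].
have q_sub (F : (set borelS)^nat) : (forall n, measurable (F n)) ->
    (q (\bigcup_n F n) <= \sum_(n <oo) q (F n))%E.
  move=> mF; have mUF : measurable (\bigcup_n F n) by exact: bigcupT_measurable.
  rewrite /q -integral_nneseries//; last by move=> n; exact: mcm.
  apply: ge0_le_integral => //.
  - exact: mcm.
  - by apply: ge0_emeasurable_sum => // n _; exact: mcm.
  move=> w _.
  (* If one [F n] already has mass at least [1], its term bounds the capped mass; otherwise no cap
     is active on the right and subadditivity of [M w] applies. *)
  have [[n hn]|hn] := pselect (exists n, 1 <= fine (M w (B `&` F n))).
    apply: (@le_trans _ _ (capped_mass B (F n) w)%:E).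
      rewrite lee_fin /capped_mass (min_l hn); have /andP[_] := capped_mass01 B (\bigcup_n F n) w.
      by [].
    by rewrite (nneseriesD1 (n := n))// leeDl// nneseries_ge0.
  apply: (@le_trans _ _ (M w (B `&` \bigcup_n F n))).
    rewrite -(fineK (mass_fin _ mB bB mUF)) lee_fin /capped_mass.
    by rewrite ge_min lexx orbT.
  rewrite setI_bigcupr.
  apply: (le_trans (measure_sigma_subadditive (M w) (F := fun n => B `&` F n) _ _ _)) => //.
  - by move=> n; exact: measurableI.
  - by apply: bigcupT_measurable => n; exact: measurableI.
  rewrite (eq_eseriesr (g := fun n => (capped_mass B (F n) w)%:E))// => n _.
  rewrite -(fineK (mass_fin w mB bB (mF n))) /capped_mass min_r//.
  by rewrite leNgt; apply/negP => h; apply: hn; exists n; exact: ltW.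
have q_cvg0 (F : (set borelS)^nat) : (forall n, measurable (F n)) ->
    nonincreasing_seq F -> \bigcap_n F n = set0 -> q (F n) @[n --> \oo] --> 0%E.
  move=> mF dF F0.
  have h : \int[P]_w `|capped_mass B (F n) w - cst 0 w| @[n --> \oo] --> 0.
    apply: (@bounded_convergence _ _ _ P (fun n => capped_mass B (F n)) (cst 0) 1) => //.
    - by move=> n; exact: capped_mass_measurable.
    - by move=> n w; have /andP[? ?] := capped_mass01 B (F n) w; rewrite ger0_norm.
    move=> w; have hm : fine (M w (B `&` F n)) @[n --> \oo] --> (0 : R).
      have : (M w \o (fun n => B `&` F n)) n @[n --> \oo] --> M w (\bigcap_n (B `&` F n)).
        apply: nonincreasing_cvg_mu.
        - by rewrite -ge0_fin_numE// mass_fin.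
        - by move=> i; exact: measurableI.
        - by apply: bigcapT_measurable => i; exact: measurableI.
        - by move=> m n mn; apply/subsetPset; apply: setIS; apply/subsetPset; exact: dF.
      have -> : \bigcap_n (B `&` F n) = set0.
        rewrite -subset0 -F0 => x hx n _; exact: (hx n I).2.
      by rewrite measure0 => /fine_cvgP[].
    apply: (squeeze_cvgr _ (cvg_cst 0) hm); apply: nearW => n.
    by rewrite /capped_mass le_min ler01 fine_ge0//= ge_min lexx orbT.
  rewrite (_ : (fun n => q (F n)) = fun n => (\int[P]_w `|capped_mass B (F n) w - cst 0 w|)%:E).
    by rewrite -[0%E]/((0 : R)%:E); apply/fine_cvgP; split; [exact: nearW|exact: h].
  apply/funext => n; rewrite /q (@bounded_expectationE _ _ _ P _ 1).
  - congr EFin; apply: eq_Rintegral => w _.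
    by rewrite subr0 ger0_norm//; have /andP[] := capped_mass01 B (F n) w.
  - exact: capped_mass_measurable.
  - by move=> w; have /andP[? ?] := capped_mass01 B (F n) w; rewrite ger0_norm.
have [_ /(_ _ dl0)[K [cK KX qK]]] := closed_inner_regular q0 q_ge0 q_le q_sub q_cvg0 mX.
exists K; split => //; rewrite -lee_fin; apply: le_trans qK.
rewrite /q (@bounded_expectationE _ _ _ P (capped_mass B (X `\` K)) 1)//.
- by apply: capped_mass_measurable => //; apply: measurableD => //; exact: closed_borel.
- by move=> w; have /andP[? ?] := capped_mass01 B (X `\` K) w; rewrite ger0_norm.
Qed.

End closed_approximation.

(** * Vaguely continuous functionals and separating bumps *)

Section vague_functionals.
Context (R : realType) (S : completePseudoMetricType R).
Local Notation MS := (MS S).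
Local Notation borelS := (borelS S).
Local Notation measurable_measures := (measurable_measures S).

Lemma continuous_borel_measurable (g : S -> R) : continuous g ->
  measurable_fun setT (g : borelS -> R).
Proof.
move=> cg; apply: (measurability _ (RGenOInfty.measurableE R)).
move=> _ [_ [a ->] <-]; rewrite setTI; apply: open_borel.
by apply: open_comp; [move=> x _; exact: cg|exact: interval_open].
Qed.

Lemma integral_restr (mu : MS) (A : set borelS) (mA : measurable A) (g : borelS -> \bar R) :
  (forall x, ~ A x -> g x = 0%E) ->
  (\int[restr mA mu]_x g x = \int[mu]_x g x)%E.
Proof.
move=> gA; have gE : g = g \_ A.
  by apply/funext => x; rewrite patchE; case: ifPn => // /negP; rewrite inE => /gA.
rewrite gE -!integral_mkcond; apply: eq_measure_integral => B mB BA.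
by rewrite /= /mrestr setIidl.
Qed.

(* Test functions with values in [0, 1]; elements of [CcS] need not be bounded. *)
Definition test_function (g : S -> R) := CcS g /\ forall x, g x <= 1.

Definition vmass (mu : MS) (g : S -> R) : R := fine (vint mu g).

Section one_test_function.
Variables (g : S -> R) (tg : test_function g).

Let mg : measurable_fun setT (fun x : borelS => (g x)%:E).
Proof. by apply/measurable_EFinP; apply: continuous_borel_measurable; case: tg => -[]. Qed.

Let supp : set borelS := closure [set x | g x != 0].

Let msupp : measurable supp.
Proof. by apply: closed_borel; exact: closed_closure. Qed.

Let bsupp : mbounded supp. Proof. by case: tg => -[_ []]. Qed.

Let g0 x : ~ supp x -> (g x)%:E = 0%E.
Proof.
move=> h; congr EFin; apply: contrapT => /eqP gx; apply: h.
exact: subset_closure.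
Qed.

Let g_ge0 x : (0 <= (g x)%:E)%E. Proof. by rewrite lee_fin; case: tg => -[_ []]. Qed.

Lemma vint_ge0 mu : (0 <= vint mu g)%E.
Proof. by apply: integral_ge0. Qed.

Lemma vint_meas_le mu nu : meas_le mu nu -> (vint mu g <= vint nu g)%E.
Proof.
move=> h; rewrite /vint -(integral_restr mu msupp g0) -(integral_restr nu msupp g0).
apply: ge0_le_measure_integral => // B mB; rewrite /= /mrestr; apply: h.
  exact: measurableI.
by have [x [r hr]] := bsupp; exists x, r => y [_ /hr].
Qed.

Lemma vint_fin mu : locfin mu -> vint mu g \is a fin_num.
Proof.
move=> lmu; rewrite ge0_fin_numE ?vint_ge0//.
apply: (@le_lt_trans _ _ (mu supp)); last exact: lmu.
rewrite -[X in (_ <= mu X)%E]setIT -integral_indic//.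
  apply: ge0_le_integral => //.
    by apply/measurable_EFinP; exact: measurable_indic.
  move=> x _; rewrite indicE; case: (boolP (x \in supp)) => [_|].
    by rewrite lee_fin; case: tg.
  by move=> /negP; rewrite inE => /g0 ->.
Qed.

Lemma vint_restr mu (A : set borelS) (mA : measurable A) :
  (forall x, g x != 0 -> A x) -> vint (restr mA mu) g = vint mu g.
Proof.
move=> gA; apply: integral_restr => x nA; congr EFin; apply: contrapT => /eqP.
by move=> /gA.
Qed.

Lemma vmass_measurable :
  measurable_fun setT (fun mu : measurable_measures => vmass mu g).
Proof.
apply: (measurableT_comp (f := @fine R)) => //.
apply: (measurable_fun_integral_kernel (l := fun mu : measurable_measures => (mu : MS))) => //.
by move=> U mU; exact: eval_measurable.
Qed.

End one_test_function.

(** Test integrals are finite on [locfin], so closeness of their real parts within [dl] is a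
    neighbourhood condition in the extended reals, and finitely many such conditions control [h]. *)
Lemma vague_continuous_lipschitz (h : MS -> R) (gs : seq (S -> R)) (L : R) : 0 <= L ->
  (forall g, g \in gs -> test_function g) ->
  (forall mu nu, locfin mu -> locfin nu ->
    `|h nu - h mu| <= L * \sum_(g <- gs) `|vmass nu g - vmass mu g|) ->
  vague_continuous h.
Proof.
move=> L0 tgs hL mu lmu e e0.
have p : 0 < L * (size gs)%:R + 1 by rewrite ltr_wpDl// mulr_ge0.
pose dl := e / (L * (size gs)%:R + 1).
have dl0 : 0 < dl by exact: divr_gt0.
exists (size gs), (fun i => nth (fun=> 0) gs i),
  (fun i => [set z | `|vmass mu (nth (fun=> 0) gs i) - fine z| <= dl]).
split => [i ilt|nu lnu hnu].
  have tg : test_function (nth (fun=> 0) gs i) by apply: tgs; exact: mem_nth.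
  split; first by case: tg.
  have /fine_cvgP[_ /cvgrPdist_le/(_ _ dl0)] : id @ nbhs (vmass mu (nth (fun=> 0) gs i))%:E -->
      (vmass mu (nth (fun=> 0) gs i))%:E by exact: cvg_id.
  by rewrite /vmass fineK ?vint_fin.
apply: (le_lt_trans (hL _ _ lmu lnu)).
have : \sum_(g <- gs) `|vmass nu g - vmass mu g| <= (size gs)%:R * dl.
  rewrite (big_nth (fun=> 0)) big_mkord.
  apply: (@le_trans _ _ (\sum_(i < size gs) dl)).
    by apply: ler_sum => i _; rewrite distrC; exact: hnu.
  by rewrite sumr_const card_ord mulr_natl.
move=> /(ler_wpM2l L0)/le_lt_trans; apply.
by rewrite mulrA /dl mulrA ltr_pdivrMr// mulrC ltr_pM2l// ltrDl.
Qed.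

(** The coordinates keep their names [B] while masses become integrals of [g B], so that [F] and its
    [oslip] bound carry over unchanged. *)
Definition cylinder (F : (set borelS -> R) -> R) (g : set borelS -> S -> R) (mu : MS) : R :=
  F (fun B => vmass mu (g B)).

Section one_cylinder.
Variables (F : (set borelS -> R) -> R) (L : R) (Bs : seq (set borelS)).
Variables (g : set borelS -> S -> R) (C : R).
Hypothesis oF : oslip F L Bs.
Hypothesis FC : forall y, `|F y| <= C.
Hypothesis tg : forall B, test_function (g B).

Lemma cylinder_lipschitz mu nu :
  `|cylinder F g nu - cylinder F g mu| <=
  L * \sum_(k <- map g Bs) `|vmass nu k - vmass mu k|.
Proof. by rewrite big_map; exact: oslip_lipschitz. Qed.

Lemma cylinder_measurable : MS_measurable_fun (cylinder F g).
Proof.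
move=> E mE; rewrite -measurable_measuresE.
have h : measurable_fun setT (cylinder F g : measurable_measures -> R).
  apply: (oslip_measurable (y := fun (mu : measurable_measures) B => vmass mu (g B)) oF) => B _.
  exact: vmass_measurable.
by rewrite -[X in measurable X]setTI; exact: h.
Qed.

Lemma cylinder_nondecreasing : MS_nondecreasing (cylinder F g).
Proof.
move=> mu nu lmu lnu munu; apply: (oslip_nondecreasing oF) => B _.
by apply: fine_le; [exact: vint_fin..|exact: vint_meas_le].
Qed.

Lemma cylinder_wrt (A : set borelS) (mA : measurable A) :
  (forall B x, g B x != 0 -> A x) -> MS_fun_wrt mA (cylinder F g).
Proof.
move=> gA mu lmu; apply: (oslip_eq oF) => B _; rewrite /vmass vint_restr//.
exact: gA.
Qed.

End one_cylinder.

(** The inner factor confines the bump to points nearer to [C] than to [D], in a neighbourhood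
    shrinking with [m]; the outer factor lifts the values on [C] to [1]. The shift to [m + 2] keeps
    the inner factor at least [2], which bounds the support already for [m = 0]. *)
Definition separating_bump (m : nat) (C D : set S) (x : S) : R :=
  Num.min 1 (m.+2%:R * Num.max 0 (capdist D x - m.+2%:R * capdist C x)).

Section bumps.
Variables (C D : set S).
Hypothesis bC : exists x r, C `<=` ball x r.

Lemma separating_bump_neq0 m x : separating_bump m C D x != 0 ->
  m.+2%:R * capdist C x < capdist D x.
Proof.
move=> h; rewrite ltNge; apply/negP => h'; move/eqP: h; apply.
rewrite /separating_bump (max_idPl _) ?subr_le0// mulr0.
by apply/min_idPr.
Qed.

Lemma separating_bump01 m x : 0 <= separating_bump m C D x <= 1.
Proof.
rewrite /separating_bump le_min ler01/= mulr_ge0 ?le_max ?lexx//=.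
by rewrite ge_min lexx.
Qed.

Lemma separating_bump_continuous m : continuous (separating_bump m C D).
Proof.
rewrite (_ : separating_bump m C D = fun x =>
  (1 + m.+2%:R * ((0 + (capdist D x - m.+2%:R * capdist C x) +
      `|0 - (capdist D x - m.+2%:R * capdist C x)|) / 2) -
   `|1 - m.+2%:R * ((0 + (capdist D x - m.+2%:R * capdist C x) +
      `|0 - (capdist D x - m.+2%:R * capdist C x)|) / 2)|) / 2); last first.
  by apply/funext => x; rewrite /separating_bump minr_absE maxr_absE.
have cd x : (capdist D y - m.+2%:R * capdist C y) @[y --> x] -->
    (capdist D x - m.+2%:R * capdist C x).
  apply: cvgB; first exact: capdist_continuous.
  by apply: cvgM; [exact: cvg_cst|exact: capdist_continuous].
have cm x : (m.+2%:R * ((0 + (capdist D y - m.+2%:R * capdist C y) +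
      `|0 - (capdist D y - m.+2%:R * capdist C y)|) / 2)) @[y --> x] -->
    (m.+2%:R * ((0 + (capdist D x - m.+2%:R * capdist C x) +
      `|0 - (capdist D x - m.+2%:R * capdist C x)|) / 2)).
  apply: cvgM; first exact: cvg_cst.
  apply: cvgM; last exact: cvg_cst.
  apply: cvgD; first by apply: cvgD; [exact: cvg_cst|exact: cd].
  by apply: cvg_norm; apply: cvgB; [exact: cvg_cst|exact: cd].
move=> x; apply: cvgM; last exact: cvg_cst.
apply: cvgB; first by apply: cvgD; [exact: cvg_cst|exact: cm].
by apply: cvg_norm; apply: cvgB; [exact: cvg_cst|exact: cm].
Qed.

(** One half is below the cap, so [halo] is bounded together with [C]. It contains the supports of
    the bumps for all [m], hence its indicator is an integrable majorant. *)
Let halo : set S := [set x | capdist C x <= 2^-1].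

Let closed_halo : closed halo.
Proof.
have := @closed_comp _ _ (capdist C) [set r : R | r <= 2^-1].
by apply; [move=> x _; exact: capdist_continuous|exact: closed_le].
Qed.

Let bounded_halo : exists x r, halo `<=` ball x r.
Proof.
have [x [r Cr]] := bC; exists x, (r + 1) => y hy.
have h : capdist C y < 1 by rewrite (le_lt_trans hy)// invf_lt1// ltr1n.
have [//|a Ca ya] := capdist_lt h.
by apply: ball_triangle (Cr _ Ca) _; exact: ball_sym.
Qed.

Let bump_halo m x : separating_bump m C D x != 0 -> halo x.
Proof.
move=> /separating_bump_neq0 h; rewrite /halo/= -[leRHS]mulr1 ler_pdivlMl//.
apply: le_trans (capdist_le1 D x); apply: le_trans (ltW h).
by rewrite ler_wpM2r ?capdist_ge0// ler_nat.
Qed.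

Lemma separating_bump_test m : test_function (separating_bump m C D).
Proof.
split; last by move=> x; have /andP[] := separating_bump01 m x.
split; first exact: separating_bump_continuous.
split; first by move=> x; have /andP[] := separating_bump01 m x.
have [x [r hr]] := bounded_halo; exists x, r.
apply: subset_trans hr; rewrite closureEbigcap => y; apply; split => //.
by move=> z; exact: bump_halo.
Qed.

(** At each point the values are eventually constant: on [C] the distance to [D] is positive, and
    off [C] the product [(m + 2) * capdist C x] ends up at least [1], the cap of [capdist D x]. *)
Lemma separating_bump_cvg : closed C -> (forall x, C x -> ~ D x) -> closed D ->
  forall x, separating_bump m C D x @[m --> \oo] --> (\1_C x : R).
Proof.
move=> cC CD cD x; have [Cx|nCx] := pselect (C x).
  rewrite indicE mem_set//=; apply: cvg_near_cst.
  have d0 : 0 < capdist D x by apply: capdist_gt0 => //; exact: CD.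
  have := near_infty_natSinv_lt (PosNum d0); apply: filterS => m /= hm.
  rewrite /separating_bump (capdist0 Cx) mulr0 subr0 (max_idPr (ltW d0)).
  apply/min_idPl; rewrite -ler_pdivrMl// mulr1; apply: le_trans (ltW hm).
  by rewrite lef_pV2 ?posrE// ler_nat.
rewrite indicE memNset//=; apply: cvg_near_cst.
have d0 : 0 < capdist C x by exact: capdist_gt0.
have := near_infty_natSinv_lt (PosNum d0); apply: filterS => m /= hm.
apply: contrapT => /eqP /separating_bump_neq0; apply/negP; rewrite -leNgt.
apply: le_trans (capdist_le1 D x) _; rewrite -ler_pdivrMl// mulr1.
apply: le_trans (ltW hm).
by rewrite lef_pV2 ?posrE// ler_nat.
Qed.

Lemma separating_bump_vmass_cvg (mu : MS) : locfin mu ->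
  closed C -> (forall x, C x -> ~ D x) -> closed D ->
  vmass mu (separating_bump m C D) @[m --> \oo] --> fine (mu C).
Proof.
move=> lmu cC CD cD.
have mh : measurable (halo : set borelS) by exact: closed_borel.
have mC : measurable (C : set borelS) by exact: closed_borel.
have mb m : measurable_fun setT (fun x : borelS => (separating_bump m C D x)%:E).
  apply/measurable_EFinP; apply: continuous_borel_measurable.
  exact: separating_bump_continuous.
have muC : mu C \is a fin_num by rewrite ge0_fin_numE//; exact: lmu.
have mi (A : set borelS) : measurable A -> measurable_fun setT (fun x : borelS => (\1_A x)%:E : \bar R).
  by move=> mA; apply/measurable_EFinP; exact: measurable_indic.
have [_ _] : [/\ mu.-integrable setT (fun x : borelS => (\1_C x)%:E),
    (\int[mu]_x `|(separating_bump m C D x)%:E - (\1_C x)%:E|)%E @[m --> \oo] --> 0%E &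
    vint mu (separating_bump m C D) @[m --> \oo] --> (\int[mu]_x (\1_C x)%:E)%E].
  apply: (@dominated_convergence _ borelS R mu setT measurableT
    (fun m x => (separating_bump m C D x)%:E) _ (fun x => (\1_halo x)%:E)) => //.
  - exact: mi.
  - apply: aeW => x _; apply: cvg_EFin; first exact: nearW.
    exact: separating_bump_cvg.
  - apply/integrableP; split; first exact: mi.
    under eq_integral do rewrite gee0_abs ?lee_fin//.
    by rewrite integral_indic// setIT; exact: lmu.
  - apply: aeW => x m _; rewrite lee_fin.
    have /andP[b0 b1] := separating_bump01 m x.
    rewrite ger0_norm// indicE; case: (boolP (x \in halo)) => // /negP; rewrite inE => nx.
    by rewrite leNgt; apply/negP => bx; apply: nx; apply: (@bump_halo m); rewrite gt_eqF.
by rewrite integral_indic// setIT -[X in _ --> X](fineK muC) => /fine_cvgP[].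
Qed.

End bumps.
End vague_functionals.

(** * Passing covariance inequalities to the limit *)

Section association_limits.
Context (R : realType) (S : completePseudoMetricType R).
Local Notation MS := (MS S).
Local Notation borelS := (borelS S).

Lemma min1D (a b : R) : 0 <= a -> 0 <= b ->
  Num.min 1 (a + b) <= Num.min 1 a + Num.min 1 b.
Proof.
move=> a0 b0; rewrite ge_min.
have [a1|a1] := leP 1 a; first by rewrite lerDl le_min ler01 b0.
have [b1|b1] := leP 1 b; first by rewrite lerDr a0.
by rewrite lexx orbT.
Qed.

Lemma min1_sum (I : Type) (s : seq I) (a : I -> R) : (forall i, 0 <= a i) ->
  Num.min 1 (\sum_(i <- s) a i) <= \sum_(i <- s) Num.min 1 (a i).
Proof.
move=> a0; elim: s => [|i s IH]; first by rewrite !big_nil ge_min lexx orbT.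
rewrite !big_cons (le_trans (min1D _ _))//; first exact: sumr_ge0.
by rewrite lerD2l.
Qed.

(** The monotone approximation is applied to [M] restricted to [A], which [f] does not distinguish
    from [M]; its coordinates are the masses of [M] on the traces of the [B] on [A], and these
    traces are then approximated from inside by [c B]. Emptiness of [c B] off [Bs] will make the
    union of all [c B] closed. *)
Lemma closed_sets_approximation d (Om : measurableType d) (P : probability Om R)
    (M : Om -> MS) (A : set borelS) (mA : measurable A) (f : MS -> R) (C e : R) :
  polish_space S -> random_measure M -> 0 < C ->
  (forall mu, locfin mu -> `|f mu| <= C) -> MS_measurable_fun f ->
  MS_nondecreasing f -> MS_fun_wrt mA f -> 0 < e ->
  exists (F : (set borelS -> R) -> R) L Bs (c : set borelS -> set S),
  [/\ oslip F L Bs, forall y, `|F y| <= C,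
    forall B, B \notin Bs -> c B = set0,
    forall B, [/\ closed (c B), c B `<=` A & exists x r, c B `<=` ball x r] &
    \int[P]_w `|F (fun B => fine (M w (c B))) - f (M w)| <= e].
Proof.
move=> HS rM C0 fC mf fup fA e0; have e20 : 0 < e / 2 by rewrite divr_gt0.
have [S_ [mS bS tS SU]] := bounded_partition HS.
have rN := restr_random_measure mA rM.
have [F [L [Bs [oF FC hBs hF]]]] := monotone_approximation mS bS tS SU P rN.1
  (random_measure_measurable rN) C0 fC mf fup e20.
have L0 := oF.1.
(* The change of [F] is at most [2 * C] and at most [L] times the lost mass, hence at most [k] times
   the lost mass capped at [1], the only quantity whose expectation is controlled. *)
pose k := 2 * C + L; have k0 : 0 < k by rewrite ltr_wpDr// mulr_gt0.
pose dl := e / 2 / (k * ((size Bs)%:R + 1)).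
have p : 0 < k * ((size Bs)%:R + 1) by rewrite mulr_gt0// ltr_wpDl.
have dl0 : 0 < dl by exact: divr_gt0.
have /choice[c hc] : forall B, exists K : set S,
    [/\ B \notin Bs -> K = set0, closed K, K `<=` B `&` A &
     B \in Bs -> \int[P]_w Num.min 1 (fine (M w (B `&` ((B `&` A) `\` K)))) <= dl].
  move=> B; have [BBs|BBs] := boolP (B \in Bs); last first.
    by exists set0; split => //; exact: closed0.
  have [mB bB] := hBs B BBs.
  have [K [cK KBA hK]] := random_measure_closed_approximation P rM mB bB
    (measurableI _ _ mB mA) dl0.
  by exists K.
exists F, L, Bs, c; split => //.
- by move=> B; case: (hc B).
- move=> B; have [cB0 cc cBA _] := hc B; split => //; first by move=> x /cBA[].
  have [/hBs[_ [x [r hr]]]|/cB0 ->] := boolP (B \in Bs).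
    by exists x, r => y /cBA[/hr].
  by exists point, 1.
have mc B : measurable (c B : set borelS) by apply: closed_borel; case: (hc B).
have mass_measurable (X : set borelS) : measurable X ->
    measurable_fun setT (fun w => fine (M w X)).
  move=> mX; apply: (measurableT_comp (f := @fine R)) => //.
  exact: (measurableT_comp (eval_measurable mX) (random_measure_measurable rM)).
pose u w := F (fun B => fine (M w (c B))).
pose v w := F (masses (restr mA (M w))).
have mu : measurable_fun setT u.
  apply: (oslip_measurable (y := fun w B => fine (M w (c B))) oF) => B _.
  exact: mass_measurable.
have mv : measurable_fun setT v.
  apply: (masses_measurable (N := restr mA \o M) _ oF) => [|B /hBs[]//].
  exact: random_measure_measurable rN.
have mfM : measurable_fun setT (f \o M).
  exact: MS_measurable_fun_comp rM.1 (random_measure_measurable rM) mf.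
have uC w : `|u w| <= C by exact: FC.
have vC w : `|v w| <= C by exact: FC.
have fMC w : `|f (M w)| <= C by apply: fC; exact: rM.1.
apply: (le_trans (expectation_dist_triangle P mu mv mfM uC vC fMC)).
rewrite [leRHS]splitr lerD//; last first.
  apply: le_trans hF; rewrite le_eqVlt; apply/orP; left; apply/eqP.
  by apply: eq_Rintegral => w _ /=; rewrite (fA _ (rM.1 w)).
pose z B w : R := Num.min 1 (fine (M w (B `&` ((B `&` A) `\` c B)))).
have z01 B w : 0 <= z B w <= 1.
  by rewrite /z le_min ler01 fine_ge0//= ge_min lexx.
have mz B : B \in Bs -> measurable_fun setT (z B).
  move=> BBs; apply: (measurable_minr (f := cst 1)) => //; apply: mass_measurable.
  have [mB _] := hBs B BBs.
  by apply: measurableI => //; apply: measurableD => //; exact: measurableI.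
pose z' B w := if B \in Bs then z B w else 0.
have mz' B : measurable_fun setT (z' B).
  rewrite /z'; case: (boolP (B \in Bs)) => // BBs; exact: mz.
have z'01 B w : 0 <= z' B w <= 1.
  by rewrite /z'; case: (B \in Bs) => //; rewrite lexx ler01.
have uv w : `|u w - v w| <= k * \sum_(B <- Bs) z' B w.
  have -> : \sum_(B <- Bs) z' B w = \sum_(B <- Bs) z B w.
    by apply: eq_big_seq => B BBs; rewrite /z' BBs.
  pose a B := fine (M w (B `&` ((B `&` A) `\` c B))).
  have a0 B : 0 <= a B by exact: fine_ge0.
  apply: (@le_trans _ _ (k * Num.min 1 (\sum_(B <- Bs) a B))); last first.
    by rewrite ler_pM2l//; exact: min1_sum.
  have h1 : `|u w - v w| <= 2 * C.
    by rewrite (le_trans (ler_normB _ _))// [leRHS]mulr_natl mulr2n lerD.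
  have h2 : `|u w - v w| <= L * \sum_(B <- Bs) a B.
    rewrite distrC (le_trans (oslip_lipschitz _ _ oF))// ler_wpM2l//.
    rewrite big_seq [leRHS]big_seq; apply: ler_sum => B BBs.
    have [mB bB] := hBs B BBs; have [_ _ cBA _] := hc B.
    have mBA : measurable (B `&` A) by exact: measurableI.
    have fX (X : set borelS) : measurable X -> X `<=` B -> M w X \is a fin_num.
      move=> mX XB; rewrite ge0_fin_numE//; apply: rM.1 => //.
      by have [x [r hr]] := bB; exists x, r => y /XB/hr.
    rewrite /masses/= /mrestr /a.
    have -> : B `&` ((B `&` A) `\` c B) = (B `&` A) `\` c B.
      by apply/setIidr; move=> x [[]].
    have mD : measurable ((B `&` A) `\` c B) by exact: measurableD.
    have -> : M w (B `&` A) = (M w (c B) + M w ((B `&` A) `\` c B))%E.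
      rewrite -measureU//; first by rewrite setDUK.
      by rewrite setDIK.
    rewrite fineD ?fX//; [|by move=> x /cBA[]|by move=> x [[]]].
    by rewrite addrC addKr ger0_norm// fine_ge0.
  have [s1|s1] := leP 1 (\sum_(B <- Bs) a B).
    by rewrite mulr1 (le_trans h1)// lerDl.
  apply: (le_trans h2); rewrite ler_wpM2r ?sumr_ge0// lerDr.
  by rewrite mulr_ge0// ltW.
have Bs1 w : \sum_(B <- Bs) z' B w <= (size Bs)%:R.
  rewrite -sum1_size natr_sum; apply: ler_sum => B _.
  by have /andP[] := z'01 B w.
have intz : \int[P]_w \sum_(B <- Bs) z' B w <= (size Bs)%:R * dl.
  have hz' B : B \in Bs -> \int[P]_w z' B w <= dl.
    move=> BBs; have [_ _ _ /(_ BBs) h] := hc B; apply: le_trans h.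
    by rewrite le_eqVlt; apply/orP; left; apply/eqP; apply: eq_Rintegral => w _; rewrite /z' BBs.
  have : {subset Bs <= Bs} by [].
  elim: {1 3 4}Bs => [_|B s IH sB].
    under eq_Rintegral do rewrite big_nil.
    by rewrite (Rintegral_prob_cst P) mul0r.
  under eq_Rintegral do rewrite big_cons.
  rewrite RintegralD//; last 2 first.
  - apply: (@bounded_integrable _ _ _ P _ 1) => // w.
    by have /andP[? ?] := z'01 B w; rewrite ger0_norm.
  - apply: (@bounded_integrable _ _ _ P _ (size s)%:R).
      by apply: measurable_sum.
    move=> w; rewrite ger0_norm; last by apply: sumr_ge0 => i _; have /andP[] := z'01 i w.
    rewrite -sum1_size natr_sum; apply: ler_sum => i _.
    by have /andP[] := z'01 i w.
  rewrite [size _]/= -natr1 mulrDl mul1r [leRHS]addrC lerD//.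
    by apply: hz'; apply: sB; rewrite mem_head.
  by apply: IH => x xs; apply: sB; rewrite inE xs orbT.
apply: (@le_trans _ _ (\int[P]_w (k * \sum_(B <- Bs) z' B w))).
  apply: (bounded_expectation_le P (C := C + C) (C' := k * (size Bs)%:R)) => //.
  - exact: dist_measurable.
  - by apply: (measurable_funM (f := cst k)) => //; exact: measurable_sum.
  - by move=> w; exact: dist_bounded.
  - move=> w; rewrite ger0_norm; first by rewrite ler_pM2l.
    by rewrite mulr_ge0 ?(ltW k0)// sumr_ge0// => i _; have /andP[] := z'01 i w.
rewrite RintegralZl//; last first.
  apply: (@bounded_integrable _ _ _ P _ (size Bs)%:R); first exact: measurable_sum.
  by move=> w; rewrite ger0_norm// sumr_ge0// => i _; have /andP[] := z'01 i w.
apply: (le_trans (ler_wpM2l (ltW k0) intz)).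
rewrite mulrA /dl mulrA ler_pdivrMr// mulrC ler_pM2l// ler_pM2l// lerDl//.
Qed.

Definition real_covariance d (Om : measurableType d) (P : probability Om R)
    (M : Om -> MS) (h h' : MS -> R) : R :=
  \int[P]_w (h (M w) * h' (M w)) - (\int[P]_w h (M w)) * (\int[P]_w h' (M w)).

Section convergent_sequence.
Variables (dn : nat -> measure_display) (Omn : forall n, measurableType (dn n)).
Variables (Pn : forall n, probability (Omn n) R) (Mn : forall n, Omn n -> MS).
Context d (Om : measurableType d) (P : probability Om R) (M : Om -> MS).
Hypothesis rMn : forall n, random_measure (@Mn n).
Hypothesis rM : random_measure M.
Hypothesis cM : cvg_in_dist Pn Mn P M.

Lemma expectation_cvg (h : MS -> R) (C : R) : MS_measurable_fun h ->
  (forall mu, `|h mu| <= C) -> vague_continuous h ->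
  \int[Pn n]_w h (Mn w) @[n --> \oo] --> \int[P]_w h (M w).
Proof.
move=> mh hC vh.
have mhN d' (Om' : measurableType d') (N : Om' -> MS) : random_measure N ->
    measurable_fun setT (h \o N).
  by move=> rN; exact: MS_measurable_fun_comp rN.1 (random_measure_measurable rN) mh.
have := cM (ex_intro _ C (fun mu _ => hC mu)) vh; rewrite /expect.
rewrite (bounded_expectationE P (mhN _ _ _ rM) (fun w => hC (M w))).
rewrite (_ : (fun n => _) = fun n => (\int[Pn n]_w h (Mn w))%:E); last first.
  by apply/funext => n; exact: (bounded_expectationE (Pn n) (mhN _ _ _ (rMn n)) (fun w => hC (Mn w))).
by move=> /fine_cvgP[].
Qed.

(** The mean of the product converges as well, because the product of two cylinders bounded by [C]
    is again Lipschitz in finitely many test integrals, with constant [C * (L + L')]. *)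
Lemma covariance_cvg (F F' : (set borelS -> R) -> R) (L L' : R) (Bs Bs' : seq (set borelS))
    (g g' : set borelS -> S -> R) (C : R) :
  oslip F L Bs -> oslip F' L' Bs' -> (forall y, `|F y| <= C) -> (forall y, `|F' y| <= C) ->
  (forall B, test_function (g B)) -> (forall B, test_function (g' B)) ->
  real_covariance (Pn n) (@Mn n) (cylinder F g) (cylinder F' g') @[n --> \oo] -->
  real_covariance P M (cylinder F g) (cylinder F' g').
Proof.
move=> oF oF' FC F'C tg tg'.
have C0 : 0 <= C by rewrite (le_trans _ (FC (fun=> 0))).
have tmap (g0 : set borelS -> S -> R) s : (forall B, test_function (g0 B)) ->
    forall k, k \in map g0 s -> test_function k.
  by move=> tg0 k /mapP[B _ ->].
have vF := vague_continuous_lipschitz oF.1 (tmap _ _ tg)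
  (fun mu nu _ _ => cylinder_lipschitz g oF mu nu).
have vF' := vague_continuous_lipschitz oF'.1 (tmap _ _ tg')
  (fun mu nu _ _ => cylinder_lipschitz g' oF' mu nu).
have mF := cylinder_measurable oF tg.
have mF' := cylinder_measurable oF' tg'.
apply: cvgB; last first.
  apply: cvgM; first exact: (expectation_cvg mF (fun mu => FC _) vF).
  exact: (expectation_cvg mF' (fun mu => F'C _) vF').
apply: (@expectation_cvg (fun mu => cylinder F g mu * cylinder F' g' mu) (C * C)).
- move=> E mE; rewrite -measurable_measuresE.
  have h (k : MS -> R) : MS_measurable_fun k ->
      measurable_fun setT (k : measurable_measures S -> R).
    by move=> mk _ X mX; rewrite setTI measurable_measuresE; exact: mk.
  have hm : measurable_fun setT
      (fun mu : measurable_measures S => cylinder F g mu * cylinder F' g' mu).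
    by apply: measurable_funM; exact: h.
  by rewrite -[X in measurable X]setTI; exact: hm.
- by move=> mu; rewrite normrM ler_pM// ?FC ?F'C.
apply: (@vague_continuous_lipschitz _ _ _ (map g Bs ++ map g' Bs') (C * (L + L'))).
- by rewrite mulr_ge0// addr_ge0// ?oF.1 ?oF'.1.
- by move=> k; rewrite mem_cat => /orP[]; exact: tmap.
move=> mu nu lmu lnu.
set a := cylinder F g; set b := cylinder F' g'.
rewrite (_ : _ - _ = (a nu - a mu) * b nu + a mu * (b nu - b mu)); last by ring.
rewrite (le_trans (ler_normD _ _))// !normrM big_cat/=.
have h1 := cylinder_lipschitz g oF mu nu.
have h2 := cylinder_lipschitz g' oF' mu nu.
move: h1 h2; rewrite -/a -/b.
have : 0 <= \sum_(k <- map g Bs) `|vmass nu k - vmass mu k| by exact: sumr_ge0.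
have : 0 <= \sum_(k <- map g' Bs') `|vmass nu k - vmass mu k| by exact: sumr_ge0.
move: (\sum_(k <- map g Bs) _) (\sum_(k <- map g' Bs') _) => s s' s'0 s0 h1 h2.
have L0 := oF.1; have L'0 := oF'.1.
apply: (@le_trans _ _ (L * s * C + C * (L' * s'))).
  by apply: lerD; apply: ler_pM => //; [exact: F'C|exact: FC].
rewrite -subr_ge0 (_ : _ - _ = C * (L * s' + L' * s)); last by ring.
by rewrite mulr_ge0// addr_ge0// mulr_ge0.
Qed.

Lemma bump_expectation_cvg (F : (set borelS -> R) -> R) (L : R) (Bs : seq (set borelS))
    (c : set borelS -> set S) (D : set S) (C : R) :
  oslip F L Bs -> (forall y, `|F y| <= C) ->
  (forall B, closed (c B) /\ exists x r, c B `<=` ball x r) ->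
  (forall B x, c B x -> ~ D x) -> closed D ->
  \int[P]_w `|cylinder F (fun B => separating_bump m (c B) D) (M w) -
              F (fun B => fine (M w (c B)))| @[m --> \oo] --> 0.
Proof.
move=> oF FC hc cD clD.
have tb m B : test_function (separating_bump m (c B) D).
  by apply: separating_bump_test; case: (hc B).
have mc B : measurable (c B : set borelS) by apply: closed_borel; case: (hc B).
apply: (@bounded_convergence _ _ _ P
  (fun m w => cylinder F (fun B => separating_bump m (c B) D) (M w))
  (fun w => F (fun B => fine (M w (c B)))) C).
- move=> m; apply: (MS_measurable_fun_comp rM.1 (random_measure_measurable rM)).
  exact: cylinder_measurable oF (tb m).
- apply: (oslip_measurable (y := fun w B => fine (M w (c B))) oF) => B _.
  apply: (measurableT_comp (f := @fine R)) => //.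
  exact: (measurableT_comp (eval_measurable (mc B)) (random_measure_measurable rM)).
- by move=> m w; exact: FC.
move=> w; apply/cvgrPdist_le => e e0.
have h : (L * \sum_(B <- Bs) `|vmass (M w) (separating_bump m (c B) D) - fine (M w (c B))|)
    @[m --> \oo] --> L * \sum_(B <- Bs) (0 : R).
  apply: cvgM; first exact: cvg_cst.
  elim: Bs {oF} => [|B s IH].
    by under eq_cvg do rewrite big_nil; rewrite big_nil; exact: cvg_cst.
  under eq_cvg do rewrite big_cons.
  rewrite big_cons; apply: cvgD => //.
  rewrite -(normr0 R); apply: cvg_norm.
  rewrite -(subrr (fine (M w (c B)))); apply: cvgB; last exact: cvg_cst.
  by apply: separating_bump_vmass_cvg => //; [case: (hc B)|exact: rM.1|case: (hc B)|exact: cD].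
move: h; rewrite big1// mulr0 => /cvgrPdist_le/(_ _ e0); apply: filterS => m.
rewrite sub0r normrN => hm; apply: le_trans hm.
apply: le_trans (ler_norm _); rewrite distrC; exact: oslip_lipschitz oF.
Qed.

(* [sg] is [1] for positive and [-1] for negative association; [sep] provides
   the sets from which the bumps around the closed sets [c B] and [c' B] are
   kept away. *)
Lemma association_limit (sg : R) (A A' : set borelS) (mA : measurable A)
    (mA' : measurable A') (f f' : MS -> R) :
  polish_space S -> `|sg| <= 1 ->
  MS_bounded_fun f -> MS_bounded_fun f' ->
  MS_measurable_fun f -> MS_measurable_fun f' ->
  MS_nondecreasing f -> MS_nondecreasing f' ->
  MS_fun_wrt mA f -> MS_fun_wrt mA' f' ->
  (forall (Bs Bs' : seq (set borelS)) (c c' : set borelS -> set S),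
    (forall B, B \notin Bs -> c B = set0) -> (forall B, B \notin Bs' -> c' B = set0) ->
    (forall B, closed (c B) /\ c B `<=` A) -> (forall B, closed (c' B) /\ c' B `<=` A') ->
    exists D D' : set S, [/\ closed D, closed D',
      forall B x, c B x -> ~ D x, forall B x, c' B x -> ~ D' x &
      forall (h h' : MS -> R),
        MS_bounded_fun h -> MS_bounded_fun h' ->
        MS_measurable_fun h -> MS_measurable_fun h' ->
        MS_nondecreasing h -> MS_nondecreasing h' ->
        (forall (W : set borelS) (mW : measurable W),
          (forall B x, capdist (c B) x < capdist D x -> W x) -> MS_fun_wrt mW h) ->
        (forall (W : set borelS) (mW : measurable W),
          (forall B x, capdist (c' B) x < capdist D' x -> W x) -> MS_fun_wrt mW h') ->
        forall n, 0 <= sg * real_covariance (Pn n) (@Mn n) h h']) ->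
  0 <= sg * real_covariance P M f f'.
Proof.
move=> HS sg1 [C0 fC0] [C0' f'C0'] mf mf' fup f'up fA f'A sep.
pose C := `|C0| + `|C0'| + 1.
have C_gt0 : 0 < C by rewrite ltr_wpDl// addr_ge0.
have fC mu : locfin mu -> `|f mu| <= C.
  move=> lmu; rewrite (le_trans (fC0 _ lmu))// (le_trans (ler_norm _))// /C -addrA lerDl.
  by rewrite addr_ge0.
have f'C mu : locfin mu -> `|f' mu| <= C.
  move=> lmu; rewrite (le_trans (f'C0' _ lmu))// (le_trans (ler_norm _))// /C.
  by rewrite addrAC lerDr addr_ge0.
have mM := random_measure_measurable rM.
apply: (covariance_sign_limit (C := C)) => //.
- exact: MS_measurable_fun_comp rM.1 mM mf.
- exact: MS_measurable_fun_comp rM.1 mM mf'.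
- by move=> w; apply: fC; exact: rM.1.
- by move=> w; apply: f'C; exact: rM.1.
move=> e e0; have e20 : 0 < e / 2 by rewrite divr_gt0.
have [F [L [Bs [c [oF FC c0 hc hF]]]]] :=
  closed_sets_approximation P HS rM C_gt0 fC mf fup fA e20.
have [F' [L' [Bs' [c' [oF' F'C c'0 hc' hF']]]]] :=
  closed_sets_approximation P HS rM C_gt0 f'C mf' f'up f'A e20.
have [D [D' [clD clD' cD c'D' hD]]] := sep Bs Bs' c c' c0 c'0
  (fun B => let: And3 p q _ := hc B in conj p q)
  (fun B => let: And3 p q _ := hc' B in conj p q).
have hb B : closed (c B) /\ exists x r, c B `<=` ball x r by case: (hc B).
have hb' B : closed (c' B) /\ exists x r, c' B `<=` ball x r by case: (hc' B).
have := bump_expectation_cvg oF FC hb cD clD.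
have := bump_expectation_cvg oF' F'C hb' c'D' clD'.
move=> /cvgrPdist_le/(_ _ e20) hm' /cvgrPdist_le/(_ _ e20) hm.
(* One [m] serves both functionals, and it is fixed before [n] tends to infinity, so the bumps do
   not change along the sequence. *)
have [m _ /(_ m (leqnn m))[hm1 hm1']] := filterI hm hm'.
pose g B := separating_bump m (c B) D; pose g' B := separating_bump m (c' B) D'.
have tg B : test_function (g B) by apply: separating_bump_test; case: (hb B).
have tg' B : test_function (g' B) by apply: separating_bump_test; case: (hb' B).
have mc B : measurable (c B : set borelS) by apply: closed_borel; case: (hc B).
have mc' B : measurable (c' B : set borelS) by apply: closed_borel; case: (hc' B).
have mg : measurable_fun setT (fun w => cylinder F g (M w)).
  exact: MS_measurable_fun_comp rM.1 mM (cylinder_measurable oF tg).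
have mg' : measurable_fun setT (fun w => cylinder F' g' (M w)).
  exact: MS_measurable_fun_comp rM.1 mM (cylinder_measurable oF' tg').
have dist_step (G : (set borelS -> R) -> R) K bs (ch : set borelS -> set S) k (h : MS -> R) :
    oslip G K bs -> (forall y, `|G y| <= C) -> (forall B, measurable (ch B : set borelS)) ->
    MS_measurable_fun h -> (forall mu, locfin mu -> `|h mu| <= C) ->
    (forall B, test_function (k B)) ->
    \int[P]_w `|G (fun B => fine (M w (ch B))) - h (M w)| <= e / 2 ->
    `|0 - \int[P]_w `|cylinder G k (M w) - G (fun B => fine (M w (ch B)))| | <= e / 2 ->
    \int[P]_w `|h (M w) - cylinder G k (M w)| <= e.
  move=> oG GC mch mh hC tk h1 h2.
  have mk : measurable_fun setT (fun w => cylinder G k (M w)).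
    exact: MS_measurable_fun_comp rM.1 mM (cylinder_measurable oG tk).
  have mG : measurable_fun setT (fun w => G (fun B => fine (M w (ch B)))).
    apply: (oslip_measurable (y := fun w B => fine (M w (ch B))) oG) => B _.
    apply: (measurableT_comp (f := @fine R)) => //.
    exact: (measurableT_comp (eval_measurable (mch B)) mM).
  have mhM := MS_measurable_fun_comp rM.1 mM mh.
  rewrite (eq_Rintegral P (g := fun w => `|cylinder G k (M w) - h (M w)|)); last first.
    by move=> w _; rewrite distrC.
  apply: (le_trans (expectation_dist_triangle P mk mG mhM (C := C) _ _ _)).
  - by move=> w; exact: GC.
  - by move=> w; exact: GC.
  - by move=> w; apply: hC; exact: rM.1.
  rewrite [leRHS]splitr lerD//.
  by move: h2; rewrite sub0r normrN; apply: le_trans; exact: ler_norm.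
exists (fun w => cylinder F g (M w)), (fun w => cylinder F' g' (M w)); split => //.
- by move=> w; exact: FC.
- by move=> w; exact: F'C.
split.
- exact: dist_step oF FC mc mf fC tg hF hm1.
- exact: dist_step oF' F'C mc' mf' f'C tg' hF' hm1'.
have hcov : (sg * real_covariance (Pn n) (@Mn n) (cylinder F g) (cylinder F' g'))
    @[n --> \oo] --> sg * real_covariance P M (cylinder F g) (cylinder F' g').
  by apply: cvgM; [exact: cvg_cst|exact: covariance_cvg oF oF' FC F'C tg tg'].
have bump_lt (E : set S) K x : separating_bump m K E x != 0 -> capdist K x < capdist E x.
  move=> /separating_bump_neq0; apply: le_lt_trans.
  by rewrite ler_peMl ?capdist_ge0// ler1n.
apply: (cvgr_to_ge hcov); apply: nearW => n; apply: hD.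
- by exists C => mu _; exact: FC.
- by exists C => mu _; exact: F'C.
- exact: cylinder_measurable oF tg.
- exact: cylinder_measurable oF' tg'.
- exact: cylinder_nondecreasing oF tg.
- exact: cylinder_nondecreasing oF' tg'.
- by move=> W mW hW; apply: (cylinder_wrt oF) => B x /bump_lt; exact: hW.
- by move=> W mW hW; apply: (cylinder_wrt oF') => B x /bump_lt; exact: hW.
Qed.

End convergent_sequence.
End association_limits.

(** * Association as a sign condition, and the two conclusions *)

Lemma MS_bounded_funM (R : realType) (S : completePseudoMetricType R) (h h' : MS S -> R) :
  MS_bounded_fun h -> MS_bounded_fun h' -> MS_bounded_fun (fun mu => h mu * h' mu).
Proof.
move=> [C hC] [C' h'C']; exists (C * C') => mu lmu.
by rewrite normrM ler_pM// ?hC ?h'C'.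
Qed.

Lemma covariance_expectE (R : realType) (S : completePseudoMetricType R)
    d (Om : measurableType d) (P : probability Om R) (M : Om -> MS S) (h h' : MS S -> R) :
  random_measure M -> MS_bounded_fun h -> MS_bounded_fun h' ->
  MS_measurable_fun h -> MS_measurable_fun h' ->
  (expect P M (fun mu => (h mu * h' mu)%R) - expect P M h * expect P M h' =
   (real_covariance P M h h')%:E)%E /\
  (expect P M h * expect P M h')%E \is a fin_num /\
  expect P M (fun mu => (h mu * h' mu)%R) \is a fin_num.
Proof.
move=> rM bh bh' mh mh'.
have mM := random_measure_measurable rM.
have eE (k : MS S -> R) : MS_bounded_fun k -> measurable_fun setT (k \o M) ->
    expect P M k = (\int[P]_w k (M w))%:E.
  by move=> [C kC] mk; exact: (bounded_expectationE P mk (fun w => kC _ (rM.1 w))).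
have mhM := MS_measurable_fun_comp rM.1 mM mh.
have mh'M := MS_measurable_fun_comp rM.1 mM mh'.
rewrite !eE//; first by exact: MS_bounded_funM.
exact: measurable_funM mhM mh'M.
Qed.

Lemma pos_assoc_covariance (R : realType) (S : completePseudoMetricType R)
    d (Om : measurableType d) (P : probability Om R) (M : Om -> MS S) (h h' : MS S -> R) :
  random_measure M -> MS_bounded_fun h -> MS_bounded_fun h' ->
  MS_measurable_fun h -> MS_measurable_fun h' ->
  (expect P M h * expect P M h' <= expect P M (fun mu => (h mu * h' mu)%R))%E <->
  0 <= 1 * real_covariance P M h h'.
Proof.
move=> rM bh bh' mh mh'.
have [hE [f1 f2]] := covariance_expectE P rM bh bh' mh mh'.
by rewrite mul1r -lee_fin -hE sube_ge0 ?f1 ?f2 ?orbT.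
Qed.

Lemma neg_assoc_covariance (R : realType) (S : completePseudoMetricType R)
    d (Om : measurableType d) (P : probability Om R) (M : Om -> MS S) (h h' : MS S -> R) :
  random_measure M -> MS_bounded_fun h -> MS_bounded_fun h' ->
  MS_measurable_fun h -> MS_measurable_fun h' ->
  (expect P M (fun mu => (h mu * h' mu)%R) <= expect P M h * expect P M h')%E <->
  0 <= -1 * real_covariance P M h h'.
Proof.
move=> rM bh bh' mh mh'.
have [hE [f1 f2]] := covariance_expectE P rM bh bh' mh mh'.
by rewrite mulN1r oppr_ge0 -lee_fin -hE sube_le0.
Qed.

(** Restriction to the whole space builds another measure with the same values; each is below the
    other, so monotonicity alone shows that [f] does not distinguish them. *)
Lemma MS_fun_wrt_setT (R : realType) (S : completePseudoMetricType R) (f : MS S -> R) :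
  MS_nondecreasing f -> MS_fun_wrt (@measurableT _ (borelS S)) f.
Proof.
move=> fup mu lmu.
have rE B : restr (@measurableT _ (borelS S)) mu B = mu B by rewrite /= /mrestr setIT.
have lr : locfin (restr (@measurableT _ (borelS S)) mu).
  by move=> B mB bB; rewrite rE; exact: lmu.
by apply/eqP; rewrite eq_le; apply/andP; split; apply: fup => // B mB bB; rewrite rE.
Qed.

Theorem theorem4p6 (R : realType) (S : completePseudoMetricType R)
  (HS : polish_space S)
  (dn : nat -> measure_display) (Omn : forall n, measurableType (dn n))
  (Pn : forall n, probability (Omn n) R) (Mn : forall n, Omn n -> MS S)
  (d : measure_display) (Om : measurableType d) (P : probability Om R)
  (M : Om -> MS S) :
  (forall n, random_measure (Mn n)) -> random_measure M ->
  cvg_in_dist Pn Mn P M ->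
  ((forall n, neg_assoc (Pn n) (Mn n)) -> neg_assoc P M) /\
  ((forall n, pos_assoc (Pn n) (Mn n)) -> pos_assoc P M).
Proof.
move=> rMn rM cM; split => [hn A B mA mB AB f f' bf bf' mf mf' fup f'up fA f'B|
  hn f f' bf bf' mf mf' fup f'up].
- apply/(neg_assoc_covariance P rM bf bf' mf mf').
  apply: (association_limit rMn rM cM (mA := mA) (mA' := mB)) => //.
    by rewrite normrN1.
  move=> Bs Bs' c c' c0 c'0 hc hc'.
  have clU (s : seq (set (borelS S))) (k : set (borelS S) -> set S) :
      (forall X, closed (k X)) -> closed (\big[setU/set0]_(X <- s) k X).
    by move=> hk; elim/big_ind : _ => //; [exact: closed0|exact: closedU].
  (* Since [c] and [c'] are empty off the two lists, these finite unions, which are closed, contain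
     every [c X] and every [c' X]. *)
  pose E := \big[setU/set0]_(X <- Bs) c X; pose E' := \big[setU/set0]_(X <- Bs') c' X.
  have sub (s : seq (set (borelS S))) (k : set (borelS S) -> set S) X :
      (forall Y, Y \notin s -> k Y = set0) -> k X `<=` \big[setU/set0]_(Y <- s) k Y.
    move=> k0 x kx; rewrite -bigcup_seq; exists X => //=.
    by apply/negPn/negP => /k0 k0X; rewrite k0X in kx.
  have EA : E `<=` A by rewrite /E -bigcup_seq => x [X _]; exact: (hc X).2.
  have E'B : E' `<=` B by rewrite /E' -bigcup_seq => x [X _]; exact: (hc' X).2.
  have EE' x : E x -> E' x -> False.
    by move=> /EA Ax /E'B Bx; have : set0 x by rewrite -AB.
  (* The bumps of each functional are kept away from all closed sets of the other. *)
  exists E', E; split.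
  - by apply: clU => X; exact: (hc' X).1.
  - by apply: clU => X; exact: (hc X).1.
  - by move=> X x /(sub Bs _ _ c0); exact: EE'.
  - by move=> X x /(sub Bs' _ _ c'0) h1 h2; exact: EE' h2 h1.
  move=> h h' bh bh' mh mh' hup h'up hW h'W n.
  have mlt (K K' : set S) : measurable ([set x | capdist K x < capdist K' x] : set (borelS S)).
    have cd k : measurable_fun setT (capdist k : borelS S -> R).
      by apply: continuous_borel_measurable; exact: capdist_continuous.
    rewrite (_ : [set x | _] = (fun x => capdist K' x - capdist K x) @^-1` `]0, +oo[).
      rewrite -[X in measurable X]setTI.
      by apply: (measurable_funB (cd K') (cd K)).
    by apply/seteqP; split => x /=; rewrite in_itv/= andbT subr_gt0.
  apply/(neg_assoc_covariance (Pn n) (rMn n) bh bh' mh mh').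
  (* The points strictly nearer to [E] than to [E'], and conversely, replace [A] and [B]; they need
     not lie in [A] and [B], only be disjoint. *)
  apply: (hn n _ _ (mlt E E') (mlt E' E)) => //.
  + by apply/seteqP; split => x //= -[h1 h2]; have := lt_trans h1 h2; rewrite ltxx.
  (* Enlarging [c X] to [E] can only decrease the distance, so a point nearer to [c X] than to [E']
     is nearer to [E] as well. *)
  + apply: hW => X x; apply: le_lt_trans; apply: capdist_subset.
    exact: sub.
  + apply: h'W => X x; apply: le_lt_trans; apply: capdist_subset.
    exact: sub.
- apply/(pos_assoc_covariance P rM bf bf' mf mf').
  apply: (association_limit rMn rM cM (mA := measurableT) (mA' := measurableT)) => //.
  + by rewrite normr1.
  + exact: MS_fun_wrt_setT.
  + exact: MS_fun_wrt_setT.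
  (* No separation is wanted here, and the capped distance to the empty set is the constant [1]. *)
  move=> Bs Bs' c c' _ _ _ _; exists set0, set0.
  split; [exact: closed0|exact: closed0|by move=> X x _|by move=> X x _|].
  move=> h h' bh bh' mh mh' hup h'up _ _ n.
  apply/(pos_assoc_covariance (Pn n) (rMn n) bh bh' mh mh').
  exact: hn.
Qed.
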